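(* Let $d\ge1$ and let $\Upsilon,\Xi\subset\mathbb{R}^d$ be bounded, open, connected sets whose boundaries are well behaved. (i) If $\Omega=\Xi+\Upsilon$ and $f$ is a continuous function on the closure of $\Omega$, then $$\Gamma_f=\lim_{l\to0^+} l^d\,Q^l\,\boldsymbol{\Gamma}_{f,l}\,(P^l)^*$$ in operator norm. (ii) If $\Omega=\Xi-\Upsilon$ and $f$ is a continuous function on the closure of $\Omega$, then $$\Theta_f=\lim_{l\to0^+} l^d\,Q^l\,\boldsymbol{\Theta}_{f,l}\,(P^l)^*$$ in operator norm.
   Context: Here $\Xi\pm\Upsilon=\{x\pm y:x\in\Xi,y\in\Upsilon\}$. The truncated correlation operator $\Gamma_f:L^2(\Upsilon)\to L^2(\Xi)$ (for $f$ on $\Xi+\Upsilon$) and the truncated convolution operator $\Theta_f:L^2(\Upsilon)\to L^2(\Xi)$ (for $f$ on $\Xi-\Upsilon$) are $$\Gamma_f(g)(x)=\int_\Upsilon f(x+y)g(y)\,dy,\qquad \Theta_f(g)(x)=\int_\Upsilon f(x-y)g(y)\,dy,\qquad x\in\Xi.$$ For a sampling length $l>0$ let $\boldsymbol{\Upsilon}_l=\{\boldsymbol{n}l\in\Upsilon:\boldsymbol{n}\in\mathbb{Z}^d\}$ and $\boldsymbol{\Xi}_l=\{\boldsymbol{n}l\in\Xi:\boldsymbol{n}\in\mathbb{Z}^d\}$. The spaces $\ell^2(\boldsymbol{\Upsilon}_l)$, $\ell^2(\boldsymbol{\Xi}_l)$ are the Hilbert spaces of complex functions on these finite sets with $\|g\|^2=\sum|g(\boldsymbol{y})|^2$.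 The discretized operators $\boldsymbol{\Gamma}_{f,l},\boldsymbol{\Theta}_{f,l}:\ell^2(\boldsymbol{\Upsilon}_l)\to\ell^2(\boldsymbol{\Xi}_l)$ are $$\boldsymbol{\Gamma}_{f,l}(g)(\boldsymbol{x})=\sum_{\boldsymbol{y}\in\boldsymbol{\Upsilon}_l}f(\boldsymbol{x}+\boldsymbol{y})g(\boldsymbol{y}),\qquad \boldsymbol{\Theta}_{f,l}(g)(\boldsymbol{x})=\sum_{\boldsymbol{y}\in\boldsymbol{\Upsilon}_l}f(\boldsymbol{x}-\boldsymbol{y})g(\boldsymbol{y}),\qquad\boldsymbol{x}\in\boldsymbol{\Xi}_l.$$ For $\boldsymbol{y}\in\boldsymbol{\Upsilon}_l$ let $C^l_{\boldsymbol{y}}=\{y\in\mathbb{R}^d:|y-\boldsymbol{y}|_\infty<l/2\}$ be the cube with center $\boldsymbol{y}$ and side length $l$, and set $\boldsymbol{\Upsilon}_l^{int}=\{\boldsymbol{y}\in\boldsymbol{\Upsilon}_l: C^l_{\boldsymbol{y}}\subset\Upsilon\}$. Let $e^l_{\boldsymbol{y}}=l^{-d/2}\mathbf{1}_{C^l_{\boldsymbol{y}}}$ if $\boldsymbol{y}\in\boldsymbol{\Upsilon}_l^{int}$ and $e^l_{\boldsymbol{y}}=0$ otherwise. The linear map $P^l:\ell^2(\boldsymbol{\Upsilon}_l)\to L^2(\Upsilon)$ is determined by $P^l(\delta_{\boldsymbol{y}})=e^l_{\boldsymbol{y}}$, where $\delta_{\boldsymbol{y}}$ is the function equal to $1$ at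 $\boldsymbol{y}$ and $0$ elsewhere. The map $Q^l:\ell^2(\boldsymbol{\Xi}_l)\to L^2(\Xi)$ is defined in the same way with $\Xi$ in place of $\Upsilon$. Set $N_l(\Upsilon)=|\boldsymbol{\Upsilon}_l\setminus\boldsymbol{\Upsilon}_l^{int}|$. The boundary of a bounded domain $\Upsilon$ is called well behaved if $\lim_{l\to0^+}l^dN_l(\Upsilon)=0$ (similarly for $\Xi$). *)

(* Defs.v *)
From HB Require Import structures.
From mathcomp Require Import all_boot all_order all_algebra finmap.
From mathcomp Require Import complex.
From mathcomp Require Import all_classical all_reals all_analysis.

Set Implicit Arguments.
Unset Strict Implicit.
Unset Printing Implicit Defensive.
Import Order.TTheory GRing.Theory Num.Theory.
Import numFieldNormedType.Exports.
Local Open Scope classical_set_scope.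
Local Open Scope ring_scope.

(* Row vectors carry the product sigma-algebra, generated by the coordinates;
   for 'rV[R]_n with R : realType this is the Borel sigma-algebra. *)
Definition measure_rV_display : measure_display -> measure_display.
Proof. exact. Qed.

Section measurable_rV.
Context {disp} {T : measurableType disp}.
Variable n : nat.

Let coors : 'I_n -> 'rV[T]_n -> T := fun i x => x ord0 i.

Let rV_set0 : g_sigma_preimage coors set0.
Proof. exact: sigma_algebra0. Qed.

Let rV_setC A : g_sigma_preimage coors A -> g_sigma_preimage coors (~` A).
Proof. exact: sigma_algebraC. Qed.

Let rV_bigcup (F : _^nat) : (forall i, g_sigma_preimage coors (F i)) ->
  g_sigma_preimage coors (\bigcup_i (F i)).
Proof. exact: sigma_algebra_bigcup. Qed.

HB.instance Definition _ := @isMeasurable.Build (measure_rV_display disp)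
  'rV[T]_n (g_sigma_preimage coors) rV_set0 rV_setC rV_bigcup.

Lemma measurable_coord (i : 'I_n) :
  measurable_fun [set: 'rV[T]_n] (fun x : 'rV[T]_n => x ord0 i).
Proof.
move=> _ Y mY; rewrite setTI; apply: sub_sigma_algebra => /=.
rewrite -bigcup_seq/=; exists i => /=; first by rewrite mem_index_enum.
by exists Y => //; rewrite setTI.
Qed.

Lemma measurable_fun_coordP {disp'} {T' : measurableType disp'}
    (f : T' -> 'rV[T]_n) :
  (forall i, measurable_fun [set: T'] (fun t => f t ord0 i)) ->
  measurable_fun [set: T'] f.
Proof.
move=> mf.
suff : g_sigma_preimage coors `<=` [set A | measurable (f @^-1` A)].
  by move=> sub _ A mA; rewrite setTI; exact: sub.
apply: smallest_sub.
  split => /=; first by rewrite preimage_set0.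
    by move=> A mA; rewrite setTD preimage_setC; exact: measurableC.
  by move=> F mF; rewrite preimage_bigcup; exact: bigcup_measurable.
rewrite -bigcup_seq/=; apply: bigcup_sub => i _ A [B mB <-] /=.
rewrite setTI -comp_preimage -[X in measurable X]setTI.
exact: mf.
Qed.

End measurable_rV.

Section rV_cons.
Context {disp} {T : measurableType disp}.
Variable n : nat.

Definition rV_cons (p : T * 'rV[T]_n) : 'rV[T]_n.+1 :=
  \row_(i < n.+1) if unlift ord0 i is Some j then p.2 ord0 j else p.1.

Definition rV_uncons (x : 'rV[T]_n.+1) : T * 'rV[T]_n :=
  (x ord0 ord0, \row_(j < n) x ord0 (lift ord0 j)).

Lemma rV_consK : cancel rV_cons rV_uncons.
Proof.
move=> [a v]; rewrite /rV_uncons; congr pair; first by rewrite mxE unlift_none.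
by apply/rowP => j; rewrite !mxE liftK.
Qed.

Lemma rV_unconsK : cancel rV_uncons rV_cons.
Proof.
move=> x; apply/rowP => i; rewrite mxE.
by case: unliftP => [j|] -> //; rewrite mxE.
Qed.

Lemma measurable_rV_cons : measurable_fun [set: T * 'rV[T]_n] rV_cons.
Proof.
apply: measurable_fun_coordP => i.
case: (unliftP ord0 i) => [j|] ->.
  rewrite (_ : (fun _ => _) = (fun v : 'rV[T]_n => v ord0 j) \o snd).
    exact: (measurableT_comp (measurable_coord j)).
  by apply/funext => p; rewrite mxE liftK.
rewrite (_ : (fun _ => _) = fst)//.
by apply/funext => p; rewrite mxE unlift_none.
Qed.

Lemma measurable_rV_uncons : measurable_fun [set: 'rV[T]_n.+1] rV_uncons.
Proof.
apply/measurable_fun_pair => /=; first exact: measurable_coord.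
apply: measurable_fun_coordP => i.
rewrite (_ : (fun _ => _) = fun x : 'rV[T]_n.+1 => x ord0 (lift ord0 i)).
  exact: measurable_coord.
by apply/funext => x; rewrite mxE.
Qed.

End rV_cons.

(* Lebesgue measure on R^n, by recursion on n: the Lebesgue measure on R times
   the Lebesgue measure on R^n, transported to R^(n+1). *)
Section lebesgue_rV.
Context {R : realType}.
Local Open Scope ereal_scope.

Section step.
Variable n : nat.
Variable m : {sigma_finite_measure set 'rV[R]_n -> \bar R}.

Definition rV_cons_measure : set 'rV[R]_n.+1 -> \bar R :=
  pushforward (@lebesgue_measure R \x m) (@rV_cons _ R n).

Let mcons : measurable_fun [set: measurableTypeR R * 'rV[R]_n]
  (@rV_cons _ R n).
Proof. exact: measurable_rV_cons. Qed.

Let muncons : measurable_fun [set: 'rV[R]_n.+1]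
  (@rV_uncons _ R n : _ -> measurableTypeR R * 'rV[R]_n).
Proof. exact: measurable_rV_uncons. Qed.

Let m0 : rV_cons_measure set0 = 0.
Proof. by rewrite /rV_cons_measure /pushforward preimage_set0 measure0. Qed.

Let m_ge0 A : 0 <= rV_cons_measure A.
Proof. exact: measure_ge0. Qed.

Let m_sigma_additive : semi_sigma_additive rV_cons_measure.
Proof.
move=> F mF tF mUF; rewrite /rV_cons_measure /pushforward preimage_bigcup.
apply: measure_semi_sigma_additive.
- by move=> k; rewrite -[X in measurable X]setTI; exact: mcons.
- apply/trivIsetP => /= i j _ _ ij; rewrite -preimage_setI.
  by move/trivIsetP : tF => /(_ _ _ _ _ ij) ->//; rewrite preimage_set0.
- by rewrite -preimage_bigcup -[X in measurable X]setTI; exact: mcons.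
Qed.

HB.instance Definition _ := isMeasure.Build _ _ _ rV_cons_measure
  m0 m_ge0 m_sigma_additive.

Let m_sigma_finite : sigma_finite setT rV_cons_measure.
Proof.
have /sigma_finiteP[F [TF ndF Foo]] := sigma_finiteT (@lebesgue_measure R).
have /sigma_finiteP[G [TG ndG Goo]] := sigma_finiteT m.
exists (fun k => @rV_uncons _ R n @^-1` (F k `*` G k)).
  apply/esym; rewrite -subTset => x _.
  have [i _ Fi] : (\bigcup_i F i) (rV_uncons x).1 by rewrite -TF.
  have [j _ Gj] : (\bigcup_j G j) (rV_uncons x).2 by rewrite -TG.
  exists (maxn i j) => //; split.
    by move: Fi; exact/subsetPset/ndF/leq_maxl.
  by move: Gj; exact/subsetPset/ndG/leq_maxr.
move=> k; have [mF Fk] := Foo k; have [mG Gk] := Goo k; split.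
  by rewrite -[X in measurable X]setTI; apply: muncons => //; exact: measurableX.
rewrite /rV_cons_measure /pushforward -comp_preimage.
rewrite (_ : _ \o _ = id); last by apply/funext => p /=; exact: rV_consK.
by rewrite preimage_id product_measure1E// lte_mul_pinfty// ge0_fin_numE.
Qed.

HB.instance Definition _ := Measure_isSigmaFinite.Build _ _ _ rV_cons_measure
  m_sigma_finite.

End step.

Fixpoint lebesgue_rV (n : nat) : {sigma_finite_measure set 'rV[R]_n -> \bar R} :=
  if n is k.+1 then rV_cons_measure (lebesgue_rV k) else \d_(0%R : 'rV[R]_0).

Lemma lebesgue_rV_box (n : nat) (A : 'I_n -> set R) :
  (forall i, measurable (A i)) ->
  lebesgue_rV n [set x | forall i, A i (x ord0 i)] =
  \prod_(i < n) @lebesgue_measure R (A i).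
Proof.
elim: n A => [|n IHn] A mA.
  rewrite big_ord0 /= diracE (_ : _ \in _)//.
  by apply/mem_set => -[].
rewrite big_ord_recl -IHn; last by move=> i; exact: mA.
rewrite /= /rV_cons_measure /pushforward -product_measure1E//=; first last.
- rewrite [X in measurable X](_ : _ = \bigcap_(i in [set: 'I_n])
      ((fun x : 'rV[R]_n => x ord0 i) @^-1` A (lift ord0 i))).
    apply: fin_bigcap_measurable => // i _.
    by rewrite -[X in measurable X]setTI; apply: measurable_coord => //; exact: mA.
  by apply/seteqP; split=> x /= Ax i => [_|]; exact: Ax.
- exact: mA.
congr ((_ \x _) _); apply/seteqP; split=> -[a v] /=.
  move=> Av; split; first by have := Av ord0; rewrite mxE unlift_none.
  by move=> i; have := Av (lift ord0 i); rewrite mxE liftK.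
move=> [Aa Av] i; rewrite mxE.
by case: unliftP => [j|] ->.
Qed.

End lebesgue_rV.

Section complex_L2.
Context {R : realType} {disp} {T : measurableType disp}.
Variable mu : {measure set T -> \bar R}.
Implicit Types (D : set T) (g h : T -> R[i]).

Definition cmeasurable_fun D g :=
  measurable_fun D (fun x => complex.Re (g x)) /\
  measurable_fun D (fun x => complex.Im (g x)).

Definition Cintegral D g : R[i] :=
  Complex (\int[mu]_(x in D) complex.Re (g x))
          (\int[mu]_(x in D) complex.Im (g x)).

Definition L2norm D g : \bar R :=
  ((\int[mu]_(x in D) ((Normc.normc (g x)) ^+ 2)%:E) `^ (2^-1))%E.

(* Elements of L^2(D) are represented by functions, of which only the values on
   D matter; g and h represent the same element when g = h a.e. on D. *)
Definition L2 D g := cmeasurable_fun D g /\ (L2norm D g < +oo)%E.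

Definition L2dot D g h : R[i] := Cintegral D (fun x => g x * conjc (h x)).

Definition ae_eq_on D g h := {ae mu, forall x, D x -> g x = h x}.

End complex_L2.

Section operators.
Context {R : realType} {disp disp'} {T : measurableType disp}
  {T' : measurableType disp'}.
Variables (mu : {measure set T -> \bar R}) (mu' : {measure set T' -> \bar R}).
Variables (D : set T) (E : set T').
Implicit Types A B : (T -> R[i]) -> (T' -> R[i]).

Definition opnorm A : \bar R :=
  ereal_sup [set L2norm mu' E (A g) | g in
              [set g | L2 mu D g /\ (L2norm mu D g <= 1)%E]].

(* A induces a bounded linear operator L^2(D) -> L^2(E); in particular, by
   linearity and boundedness, it respects a.e. equality. *)
Record bounded_operator A : Prop := BoundedOperator {
  bounded_operator_L2 : forall g, L2 mu D g -> L2 mu' E (A g) ;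
  bounded_operator_linear : forall (c : R[i]) g h,
    L2 mu D g -> L2 mu D h ->
    ae_eq_on mu' E (A (fun x => c * g x + h x))
                   (fun x => c * A g x + A h x) ;
  bounded_operator_norm : (opnorm A < +oo)%E
}.

Definition opnorm_cvg {I : Type} (F : set_system I)
    (A_ : I -> (T -> R[i]) -> (T' -> R[i])) A :=
  [/\ \forall i \near F, bounded_operator (A_ i),
      bounded_operator A &
      opnorm (fun g x => A_ i g x - A g x) @[i --> F] --> 0%E].

End operators.

Section sampling.
Context {R : realType} {d : nat}.
Local Notation V := 'rV[R]_d.
Local Notation mu := (@lebesgue_rV R d).
Implicit Types (X Y : set V) (f g : V -> R[i]) (l : R).

Definition corr_op f Y g : V -> R[i] :=
  fun x => Cintegral mu Y (fun y => f (x + y) * g y).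

Definition conv_op f Y g : V -> R[i] :=
  fun x => Cintegral mu Y (fun y => f (x - y) * g y).

Definition lattice l Y : set V :=
  Y `&` [set l *: map_mx intr n | n in [set: 'rV[int]_d]].

(* The norm on row vectors is the sup norm. *)
Definition cube l (y : V) : set V := [set x | `|x - y| < l / 2].

Definition lattice_int l Y : set V :=
  lattice l Y `&` [set y | cube l y `<=` Y].

Definition boundary_card l Y : nat :=
  #|` fset_set (lattice l Y `\` lattice_int l Y)|.

Definition well_behaved_boundary Y :=
  l ^+ d * (boundary_card l Y)%:R @[l --> 0^'+] --> (0 : R).

(* The functions on the set lattice l Y form l^2(Y_l): for l > 0 and Y bounded,
   the lattice is finite, so the sums below are genuine. *)
Definition ell2 l Y := lattice l Y -> R[i].

Definition ell2dot l Y (a b : ell2 l Y) : R[i] :=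
  \sum_(y \in [set: lattice l Y]) a y * conjc (b y).

Definition disc_corr_op f l X Y (a : ell2 l Y) : ell2 l X :=
  fun x => \sum_(y \in [set: lattice l Y]) f (val x + val y) * a y.

Definition disc_conv_op f l X Y (a : ell2 l Y) : ell2 l X :=
  fun x => \sum_(y \in [set: lattice l Y]) f (val x - val y) * a y.

Definition sample_basis l Y (y : lattice l Y) : V -> R[i] :=
  fun t => if (val y \in lattice_int l Y) && (t \in cube l (val y))
           then (l `^ (- (d%:R / 2)))%:C%C else 0.

Definition embedding l Y (a : ell2 l Y) : V -> R[i] :=
  fun t => \sum_(y \in [set: lattice l Y]) a y * sample_basis y t.

Definition is_adjoint l Y (P : ell2 l Y -> (V -> R[i]))
    (S : (V -> R[i]) -> ell2 l Y) :=
  forall (a : ell2 l Y) g, L2 mu Y g ->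
    L2dot mu Y (P a) g = ell2dot a (S g).

(* The adjoint of P, unique on L^2(Y). *)
Definition adjoint l Y (P : ell2 l Y -> (V -> R[i])) :
    (V -> R[i]) -> ell2 l Y :=
  xget (fun _ _ => 0) [set S | is_adjoint P S].

End sampling.

Arguments embedding {R d} l Y a.
Arguments adjoint {R d l Y} P.
Arguments disc_corr_op {R d} f l X Y a.
Arguments disc_conv_op {R d} f l X Y a.

(* Main.v *)
Require Import Defs.
From HB Require Import structures.
From mathcomp Require Import all_boot all_order all_algebra finmap.
From mathcomp Require Import complex.
From mathcomp Require Import all_classical all_reals all_analysis.
From mathcomp Require Import ring lra zify measurable_realfun.

Set Implicit Arguments.
Unset Strict Implicit.
Unset Printing Implicit Defensive.
Import Order.TTheory GRing.Theory Num.Theory.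
Import numFieldNormedType.Exports.
Local Open Scope classical_set_scope.
Local Open Scope ring_scope.

(** Both truncated operators are integral operators with a kernel [k x y] equal
    to [f (x + y)] or [f (x - y)]. The sum set is bounded, so [f] is bounded and
    uniformly continuous on its closure, and [k] is bounded and uniformly
    continuous on [Xi] times [Upsilon].

    By linearity the discretized operator is also an integral operator
    ([discretizationE]). Its kernel [step_kernel l] is obtained by sampling [k]: it
    takes the value [k x0 y0] on the product of the interior cubes around lattice
    points [x0] and [y0], the factor l^d cancelling the normalizations of the two
    embeddings, and it is 0 off these products. Thus [step_kernel l - k] is
    uniformly small on the products of interior cubes and is bounded everywhere
    ([step_kernel_close]).

    What the interior cubes miss, the [gap], has measure tending to 0
    ([gap_measure_small]): every point of an open set has a ball inside that
    set, hence for small [l] lies in an interior cube or on a face of a cube,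
    and the faces form a null set.

    Finally, a kernel that is small outside exceptional sets of small measure, and
    bounded on them, has a small operator norm ([opnorm_kernel_le]). This is a
    pointwise estimate of the image function, followed by integration of its
    square. *)

(** * Complex moduli and complex-valued integrals *)

Section complex_norm.
Variable R : rcfType.
Implicit Types z w : R[i].

Lemma normc_ge0 z : 0 <= Normc.normc z.
Proof. by case: z => a b; exact: sqrtr_ge0. Qed.

Lemma sqr_normcE z :
  Normc.normc z ^+ 2 = complex.Re z ^+ 2 + complex.Im z ^+ 2.
Proof. by case: z => a b /=; rewrite sqr_sqrtr// addr_ge0 ?sqr_ge0. Qed.

Lemma normr_Re_le z : `|complex.Re z| <= Normc.normc z.
Proof.
rewrite -(ler_pXn2r (_ : 0 < 2)%N) ?nnegrE ?normc_ge0//.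
by rewrite sqr_normcE real_normK ?num_real// lerDl sqr_ge0.
Qed.

Lemma normr_Im_le z : `|complex.Im z| <= Normc.normc z.
Proof.
rewrite -(ler_pXn2r (_ : 0 < 2)%N) ?nnegrE ?normc_ge0//.
by rewrite sqr_normcE real_normK ?num_real// lerDr sqr_ge0.
Qed.

Lemma normc_le_ReIm z : Normc.normc z <= `|complex.Re z| + `|complex.Im z|.
Proof.
rewrite -(ler_pXn2r (_ : 0 < 2)%N) ?nnegrE ?normc_ge0 ?addr_ge0//.
rewrite sqr_normcE sqrrD !real_normK ?num_real// addrAC lerDl.
by rewrite mulrn_wge0// mulr_ge0.
Qed.

Lemma normcB z w : Normc.normc (z - w) <= Normc.normc z + Normc.normc w.
Proof. by rewrite -(normcN w); exact: le_normcD. Qed.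

Lemma ReD z w : complex.Re (z + w) = complex.Re z + complex.Re w.
Proof. by case: z w => ? ? []. Qed.

Lemma ImD z w : complex.Im (z + w) = complex.Im z + complex.Im w.
Proof. by case: z w => ? ? []. Qed.

Lemma ReM z w :
  complex.Re (z * w) = complex.Re z * complex.Re w - complex.Im z * complex.Im w.
Proof. by case: z w => ? ? []. Qed.

Lemma ImM z w :
  complex.Im (z * w) = complex.Re z * complex.Im w + complex.Im z * complex.Re w.
Proof. by case: z w => ? ? []. Qed.

Lemma ReJ z : complex.Re (conjc z) = complex.Re z.
Proof. by case: z. Qed.

Lemma ImJ z : complex.Im (conjc z) = - complex.Im z.
Proof. by case: z. Qed.

Lemma conjcM z w : conjc (z * w) = conjc z * conjc w.
Proof. exact: rmorphM. Qed.

End complex_norm.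

Section cmeasurable.
Context {R : realType} {disp} {T : measurableType disp}.
Implicit Types (D : set T) (g h : T -> R[i]).

Lemma cmeasurable_cst D (c : R[i]) : cmeasurable_fun D (fun=> c).
Proof. by split; exact: measurable_cst. Qed.

Lemma cmeasurable_funD D g h : cmeasurable_fun D g -> cmeasurable_fun D h ->
  cmeasurable_fun D (fun x => g x + h x).
Proof.
move=> [rg ig] [rh ih]; split.
  by under eq_fun do rewrite ReD; exact: measurable_funD.
by under eq_fun do rewrite ImD; exact: measurable_funD.
Qed.

Lemma cmeasurable_funM D g h : cmeasurable_fun D g -> cmeasurable_fun D h ->
  cmeasurable_fun D (fun x => g x * h x).
Proof.
move=> [rg ig] [rh ih]; split.
  by under eq_fun do rewrite ReM; apply: measurable_funB; exact: measurable_funM.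
by under eq_fun do rewrite ImM; apply: measurable_funD; exact: measurable_funM.
Qed.

Lemma cmeasurable_funN D g : cmeasurable_fun D g ->
  cmeasurable_fun D (fun x => - g x).
Proof.
move=> mg; under eq_fun do rewrite -mulN1r.
by apply: cmeasurable_funM => //; exact: cmeasurable_cst.
Qed.

Lemma cmeasurable_funB D g h : cmeasurable_fun D g -> cmeasurable_fun D h ->
  cmeasurable_fun D (fun x => g x - h x).
Proof. by move=> mg mh; apply: cmeasurable_funD => //; exact: cmeasurable_funN. Qed.

Lemma cmeasurable_fun_sum D (I : Type) (s : seq I) (g : I -> T -> R[i]) :
  (forall i, cmeasurable_fun D (g i)) ->
  cmeasurable_fun D (fun x => \sum_(i <- s) g i x).
Proof.
move=> mg; elim: s => [|i s IH].
  by under eq_fun do rewrite big_nil; exact: cmeasurable_cst.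
by under eq_fun do rewrite big_cons; exact: cmeasurable_funD.
Qed.

Lemma cmeasurable_if D (A : set T) (c : R[i]) : measurable A ->
  cmeasurable_fun D (fun x => if x \in A then c else 0).
Proof.
move=> mA.
rewrite (_ : (fun x => _) = fun x => c * (\1_A x : R)%:C%C).
  apply: cmeasurable_funM; first exact: cmeasurable_cst.
  split => /=; first exact: measurable_indic.
  exact: measurable_cst.
apply/funext => x; rewrite indicE.
by case: ifP => _; rewrite ?mulr1 ?mulr0.
Qed.

Lemma measurable_sqr_normc D g : cmeasurable_fun D g ->
  measurable_fun D (fun x => Normc.normc (g x) ^+ 2).
Proof.
move=> [rg ig]; under eq_fun do rewrite sqr_normcE.
by apply: measurable_funD; exact: measurable_funX.
Qed.

End cmeasurable.

Section complex_integral.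
Context {R : realType} {disp} {T : measurableType disp}.
Variables (mu : {measure set T -> \bar R}) (D : set T).
Hypothesis mD : measurable D.
Implicit Types g h : T -> R[i].

Definition Cintegrable g :=
  mu.-integrable D (EFin \o (fun x => complex.Re (g x))) /\
  mu.-integrable D (EFin \o (fun x => complex.Im (g x))).

Lemma Cintegrable_le g (h : T -> R) : cmeasurable_fun D g ->
  mu.-integrable D (EFin \o h) ->
  (forall x, D x -> Normc.normc (g x) <= h x) -> Cintegrable g.
Proof.
move=> [rg ig] ih gh; split; apply: le_integrable ih => //.
- exact/measurable_EFinP.
- move=> x Dx /=; rewrite lee_fin (le_trans _ (ler_norm _))//.
  by rewrite (le_trans _ (gh _ Dx))// normr_Re_le.
- exact/measurable_EFinP.
- move=> x Dx /=; rewrite lee_fin (le_trans _ (ler_norm _))//.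
  by rewrite (le_trans _ (gh _ Dx))// normr_Im_le.
Qed.

(** Splitting into real and imaginary parts costs a factor 2, which is
    harmless for a convergence statement and spares the usual rotation of the
    integral onto the real axis. *)
Lemma normc_Cintegral_le g (h : T -> R) : cmeasurable_fun D g ->
  mu.-integrable D (EFin \o h) ->
  (forall x, D x -> Normc.normc (g x) <= h x) ->
  Normc.normc (Cintegral mu D g) <= 2 * \int[mu]_(x in D) h x.
Proof.
move=> mg ih gh; have [rg ig] := Cintegrable_le mg ih gh.
rewrite (le_trans (normc_le_ReIm _))//= mulr_natl mulr2n lerD//.
  rewrite (le_trans (le_normr_Rintegral _ _))//.
  apply: le_Rintegral => //; first exact: integrable_norm.
  by move=> x Dx; rewrite (le_trans _ (gh _ Dx))// normr_Re_le.
rewrite (le_trans (le_normr_Rintegral _ _))//.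
apply: le_Rintegral => //; first exact: integrable_norm.
by move=> x Dx; rewrite (le_trans _ (gh _ Dx))// normr_Im_le.
Qed.

Let integrable_EFinD (u v : T -> R) : mu.-integrable D (EFin \o u) ->
  mu.-integrable D (EFin \o v) -> mu.-integrable D (EFin \o (fun x => u x + v x)).
Proof. by move=> iu iv; apply: (integrableD mD iu iv). Qed.

Let integrable_EFinZ (r : R) (u : T -> R) : mu.-integrable D (EFin \o u) ->
  mu.-integrable D (EFin \o (fun x => r * u x)).
Proof. by move=> iu; apply: (integrableZl mD r iu). Qed.

Lemma CintegrableD g h : Cintegrable g -> Cintegrable h ->
  Cintegrable (fun x => g x + h x).
Proof.
move=> [rg ig] [rh ih]; split.
  by under eq_fun do rewrite ReD; exact: integrable_EFinD.
by under eq_fun do rewrite ImD; exact: integrable_EFinD.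
Qed.

Lemma CintegrableZl c g : Cintegrable g -> Cintegrable (fun x => c * g x).
Proof.
move=> [rg ig]; split.
  under eq_fun do rewrite ReM -mulNr.
  by apply: integrable_EFinD; exact: integrable_EFinZ.
under eq_fun do rewrite ImM.
by apply: integrable_EFinD; exact: integrable_EFinZ.
Qed.

Lemma eq_Cintegral g h : (forall x, D x -> g x = h x) ->
  Cintegral mu D g = Cintegral mu D h.
Proof. by move=> gh; congr Complex; apply: eq_Rintegral => x /[!inE] /gh ->. Qed.

Lemma CintegralZl c g : Cintegrable g ->
  Cintegral mu D (fun x => c * g x) = c * Cintegral mu D g.
Proof.
move=> [rg ig]; case: c => a b; rewrite /Cintegral; apply/eqP; rewrite eq_complex /=.
under eq_Rintegral do rewrite ReM/=.
rewrite RintegralB ?RintegralZl ?eqxx//=; [|exact: integrable_EFinZ..].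
under eq_Rintegral do rewrite ImM/=.
by rewrite RintegralD ?RintegralZl ?eqxx//=; exact: integrable_EFinZ.
Qed.

Lemma CintegralD g h : Cintegrable g -> Cintegrable h ->
  Cintegral mu D (fun x => g x + h x) = Cintegral mu D g + Cintegral mu D h.
Proof.
move=> [rg ig] [rh ih]; rewrite /Cintegral; apply/eqP; rewrite eq_complex /=.
under eq_Rintegral do rewrite ReD.
rewrite RintegralD ?eqxx//=.
under eq_Rintegral do rewrite ImD.
by rewrite RintegralD.
Qed.

Lemma Cintegrable0 : Cintegrable (fun=> 0).
Proof. by split; exact: integrable0. Qed.

Lemma Cintegral0 : Cintegral mu D (fun=> 0) = 0.
Proof. by rewrite /Cintegral Rintegral_cst// mul0r. Qed.

Lemma Cintegrable_sum (I : Type) (s : seq I) (g : I -> T -> R[i]) :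
  (forall i, Cintegrable (g i)) -> Cintegrable (fun x => \sum_(i <- s) g i x).
Proof.
move=> ig; elim: s => [|i s IH].
  by under eq_fun do rewrite big_nil; exact: Cintegrable0.
by under eq_fun do rewrite big_cons; exact: CintegrableD.
Qed.

Lemma Cintegral_sum (I : Type) (s : seq I) (g : I -> T -> R[i]) :
  (forall i, Cintegrable (g i)) ->
  Cintegral mu D (fun x => \sum_(i <- s) g i x) =
  \sum_(i <- s) Cintegral mu D (g i).
Proof.
move=> ig; elim: s => [|i s IH].
  by under eq_fun do rewrite big_nil; rewrite big_nil Cintegral0.
under eq_fun do rewrite big_cons.
by rewrite big_cons CintegralD ?IH//; exact: Cintegrable_sum.
Qed.

Lemma Cintegrable_conj g : Cintegrable g -> Cintegrable (fun x => conjc (g x)).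
Proof.
move=> [rg ig]; split; first by under eq_fun do rewrite ReJ.
by under eq_fun do rewrite ImJ -mulN1r; exact: integrable_EFinZ.
Qed.

Lemma Cintegral_conj g : Cintegrable g ->
  Cintegral mu D (fun x => conjc (g x)) = conjc (Cintegral mu D g).
Proof.
move=> [rg ig]; rewrite /Cintegral; apply/eqP; rewrite eq_complex /=.
under eq_Rintegral do rewrite ReJ.
under [X in X == - _]eq_Rintegral do rewrite ImJ -mulN1r.
by rewrite eqxx RintegralZl// mulN1r/=.
Qed.

End complex_integral.

(** * Operators given by bounded kernels *)

Section square_integrable.
Context {R : realType} {disp} {T : measurableType disp}.
Variables (mu : {measure set T -> \bar R}) (D : set T).
Hypotheses (mD : measurable D) (fD : (mu D < +oo)%E).
Implicit Types g h : T -> R[i].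
Local Notation sqint g := (\int[mu]_(x in D) (Normc.normc (g x) ^+ 2)).

Let poweRy : (+oo `^ (2^-1 : R))%E = +oo%E.
Proof. by rewrite poweRyr// invr_neq0. Qed.

Lemma L2_sqr_integrable g : L2 mu D g ->
  mu.-integrable D (EFin \o (fun x => Normc.normc (g x) ^+ 2)).
Proof.
move=> [mg gfin]; apply/integrableP; split.
  exact/measurable_EFinP/measurable_sqr_normc.
under eq_integral do rewrite /= ger0_norm ?sqr_ge0//.
by rewrite ltey; apply/eqP => gy; move: gfin; rewrite /L2norm gy poweRy.
Qed.

Lemma L2norm_le1 g : L2 mu D g -> (L2norm mu D g <= 1)%E -> sqint g <= 1.
Proof.
move=> Lg; rewrite /L2norm -[X in (X `^ _)%E]fineK; last first.
  exact/integrable_fin_num/L2_sqr_integrable.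
rewrite poweR_EFin lee_fin powR12_sqrt; last first.
  by apply: Rintegral_ge0 => x _; exact: sqr_ge0.
by rewrite -[X in _ <= X -> _]sqrtr1 ler_sqrt.
Qed.

Lemma sqint_ge0 g : 0 <= sqint g.
Proof. by apply: Rintegral_ge0 => x _; exact: sqr_ge0. Qed.

Let integrable_cst (r : R) : mu.-integrable D (EFin \o (fun=> r)).
Proof.
apply/integrableP; split; first exact/measurable_EFinP/measurable_cst.
by rewrite /= integral_cst// lte_mul_pinfty.
Qed.

Let integrable_indic (S : set T) : measurable S -> 
  mu.-integrable D (EFin \o (\1_S : T -> R)).
Proof.
move=> mS; apply: (le_integrable mD) (integrable_cst 1).
  exact/measurable_EFinP/measurable_indic.
by move=> x _ /=; rewrite lee_fin indicE; case: (x \in S); rewrite ?normr1 ?normr0.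
Qed.

Let Rintegral_indic (S : set T) : measurable S -> S `<=` D ->
  \int[mu]_(x in D) (\1_S x : R) = fine (mu S).
Proof.
by move=> mS SD; rewrite /Rintegral integral_indic//; congr (fine (mu _)); exact/setIidPl.
Qed.

Let integrable_lin (u v : T -> R) (r : R) : mu.-integrable D (EFin \o u) ->
  mu.-integrable D (EFin \o v) -> mu.-integrable D (EFin \o (fun x => u x + r * v x)).
Proof.
by move=> iu iv; exact: (integrableD mD iu (integrableZl mD r iv)).
Qed.

Let Rintegral_lin (u v : T -> R) (r : R) : mu.-integrable D (EFin \o u) ->
  mu.-integrable D (EFin \o v) ->
  \int[mu]_(x in D) (u x + r * v x) =
  \int[mu]_(x in D) u x + r * \int[mu]_(x in D) v x.
Proof.
move=> iu iv; rewrite RintegralD ?RintegralZl//.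
exact: (integrableZl mD r iv).
Qed.

Lemma sqr_integrable_L2 g : cmeasurable_fun D g ->
  mu.-integrable D (EFin \o (fun x => Normc.normc (g x) ^+ 2)) -> L2 mu D g.
Proof.
move=> mg ig; split => //; rewrite /L2norm -[X in (X `^ _)%E]fineK.
  by rewrite poweR_EFin ltry.
exact: integrable_fin_num.
Qed.

Lemma L2_linear c g h : L2 mu D g -> L2 mu D h -> L2 mu D (fun x => c * g x + h x).
Proof.
move=> Lg Lh; have mgh : cmeasurable_fun D (fun x => c * g x + h x).
  apply: cmeasurable_funD; last by case: Lh.
  by apply: cmeasurable_funM; [exact: cmeasurable_cst|case: Lg].
apply: sqr_integrable_L2 => //.
have i0 : mu.-integrable D (EFin \o (fun=> 0 : R)) by exact: integrable_cst.
apply: (le_integrable mD) (integrable_lin 2 (integrable_lin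
  (2 * Normc.normc c ^+ 2) i0 (L2_sqr_integrable Lg)) (L2_sqr_integrable Lh)).
  exact/measurable_EFinP/measurable_sqr_normc.
move=> x _ /=; rewrite lee_fin ger0_norm ?sqr_ge0// (le_trans _ (ler_norm _))//.
have := le_normcD (c * g x) (h x); rewrite Normc.normcM add0r.
have := normc_ge0 (c * g x + h x).
set n := Normc.normc (_ + _); set a := Normc.normc c; set b := Normc.normc (g x).
set e := Normc.normc (h x) => n0 nle.
rewrite -mulrA -exprMn; set p := a * b in nle *.
have := lerXn2r 2 (_ : n \in Num.nneg) (_ : p + e \in Num.nneg) nle.
rewrite !nnegrE (le_trans n0 nle) => /(_ n0 isT) /le_trans; apply.
have := sqr_ge0 (p - e); nra.
Qed.

(** The set [S] is where only a crude bound [b] is available; it costs no more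
    than its measure. *)
Lemma L2norm_piecewise_le h (S : set T) (a b m eta : R) :
  cmeasurable_fun D h -> measurable S -> S `<=` D ->
  fine (mu D) <= m -> fine (mu S) <= eta ->
  (forall x, D x -> ~ S x -> Normc.normc (h x) <= a) ->
  (forall x, S x -> Normc.normc (h x) <= b) ->
  (L2norm mu D h <= (Num.sqrt (a ^+ 2 * m + b ^+ 2 * eta))%:E)%E.
Proof.
move=> mh mS SD Dm Seta ha hb.
have := integrable_lin (b ^+ 2) (integrable_cst (a ^+ 2)) (integrable_indic mS).
set u := (fun x => _) => iu.
have hu x : D x -> Normc.normc (h x) ^+ 2 <= u x.
  move=> Dx; rewrite /u indicE; case: (boolP (x \in S)) => [/set_mem|/negP] Sx.
    rewrite mulr1 (le_trans (lerXn2r _ _ _ (hb _ Sx))) ?nnegrE ?normc_ge0//.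
      by rewrite (le_trans _ (hb _ Sx)) ?normc_ge0.
    by rewrite lerDr sqr_ge0.
  have hxa : Normc.normc (h x) <= a by apply: ha => // /mem_set.
  by rewrite mulr0 addr0 lerXn2r ?nnegrE ?(le_trans _ hxa) ?normc_ge0.
have ih : mu.-integrable D (EFin \o (fun x => Normc.normc (h x) ^+ 2)).
  apply: (le_integrable mD) iu; first exact/measurable_EFinP/measurable_sqr_normc.
  by move=> x Dx; rewrite /= lee_fin ger0_norm ?sqr_ge0// (le_trans (hu _ Dx)) ?ler_norm.
rewrite /L2norm -[X in (X `^ _)%E]fineK; last exact: integrable_fin_num.
rewrite poweR_EFin lee_fin powR12_sqrt ?sqint_ge0//.
rewrite ler_wsqrtr// (le_trans (le_Rintegral mD ih iu hu))//.
rewrite /u Rintegral_lin ?Rintegral_cst ?Rintegral_indic//; last exact: integrable_indic.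
by rewrite lerD// ler_wpM2l ?sqr_ge0.
Qed.

(** The kernel slice [phi] is small outside [S] and bounded on [S]. For the
    product with [g] the pointwise inequalities |g| <= 1 + |g|^2 and
    |g| <= t + |g|^2 / t replace the Cauchy-Schwarz inequality: the free
    parameter [t] trades the measure of [S] against the square norm of [g]. *)
Lemma normc_Cintegral_kernel_le (phi : T -> R[i]) g (S : set T) (eps B m eta t : R) :
  cmeasurable_fun D phi -> L2 mu D g -> measurable S -> S `<=` D ->
  0 <= eps -> 0 <= B -> 0 < t -> fine (mu D) <= m -> fine (mu S) <= eta ->
  (forall x, D x -> Normc.normc (phi x) <= eps + B * \1_S x) ->
  Cintegrable mu D (fun x => phi x * g x) /\
  Normc.normc (Cintegral mu D (fun x => phi x * g x)) <=
  2 * (eps * (m + sqint g) + B * (t * eta + sqint g / t)).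
Proof.
move=> mphi Lg mS SD eps0 B0 t0 Dm Seta phiS.
have := integrable_lin (eps + B / t)
  (integrable_lin (B * t) (integrable_cst eps) (integrable_indic mS))
  (L2_sqr_integrable Lg).
set u := (fun x => _) => iu.
have mphig : cmeasurable_fun D (fun x => phi x * g x).
  by apply: cmeasurable_funM => //; case: Lg.
have hu x : D x -> Normc.normc (phi x * g x) <= u x.
  move=> Dx; rewrite /u Normc.normcM; set n := Normc.normc (g x).
  have n0 : 0 <= n by exact: normc_ge0.
  rewrite (le_trans (ler_wpM2r n0 (phiS _ Dx)))//.
  have n1 : n <= 1 + n ^+ 2 by nra.
  have nt : n <= t + n ^+ 2 / t.
    rewrite -(ler_pM2r t0) mulrDl divfK ?gt_eqF//; nra.
  have nt0 : 0 <= n ^+ 2 / t by rewrite divr_ge0 ?sqr_ge0 ?ltW.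
  rewrite [leRHS](_ : _ = eps * (1 + n ^+ 2) + B * (t * \1_S x + n ^+ 2 / t)); last by ring.
  rewrite mulrDl lerD ?ler_wpM2l// -mulrA ler_wpM2l//.
  by rewrite indicE; case: (x \in S); rewrite ?mul1r ?mulr1 ?mul0r ?mulr0 ?add0r.
split; first exact: (Cintegrable_le mD mphig iu hu).
rewrite (le_trans (normc_Cintegral_le mD mphig iu hu))// ler_wpM2l//.
rewrite /u Rintegral_lin//; first last.
- exact: L2_sqr_integrable.
- by apply: integrable_lin => //; exact: integrable_indic.
rewrite Rintegral_lin//; last exact: integrable_indic.
rewrite Rintegral_cst// Rintegral_indic//.
rewrite [leRHS](_ : _ = eps * m + B * t * eta + (eps + B / t) * sqint g); last by ring.
by rewrite lerD2r lerD// ler_wpM2l// mulr_ge0// ltW.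
Qed.

End square_integrable.

Section kernel_operator.
Context {R : realType} {disp disp'} {T : measurableType disp}
  {T' : measurableType disp'}.
Variables (mu : {measure set T -> \bar R}) (mu' : {measure set T' -> \bar R}).
Variables (D : set T) (E : set T').
Hypotheses (mD : measurable D) (fD : (mu D < +oo)%E).
Hypotheses (mE : measurable E) (fE : (mu' E < +oo)%E).
Implicit Types (k : T' -> T -> R[i]) (g : T -> R[i]).

Definition kernel_op k g : T' -> R[i] :=
  fun x => Cintegral mu D (fun y => k x y * g y).

Variables (A : (T -> R[i]) -> T' -> R[i]) (k : T' -> T -> R[i]).
Hypothesis Ak : forall g, L2 mu D g -> forall x, E x -> A g x = kernel_op k g x.
Hypothesis mA : forall g, L2 mu D g -> cmeasurable_fun E (A g).
Hypothesis mk : forall x, E x -> cmeasurable_fun D (k x).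

Lemma opnorm_ge0 : (0 <= opnorm mu mu' D E A)%E.
Proof.
apply: (@le_trans _ _ (L2norm mu' E (A (fun=> 0)))).
  exact: poweR_ge0.
apply: ereal_sup_ubound; exists (fun=> 0) => //=.
have L0 : L2norm mu D (fun=> 0) = 0%E.
  rewrite /L2norm Normc.normc0 expr0n/= integral0.
  by rewrite poweR0r// invr_neq0.
by split; [split; [exact: cmeasurable_cst|rewrite L0]|rewrite L0].
Qed.

(** The image function is estimated pointwise before its square is integrated:
    the bound on [A g x] is uniform and small for [x] outside [S'], and crude for
    [x] in [S'], where it is weighted by the measure of [S']. *)
Lemma opnorm_kernel_le (S : set T) (S' : set T') (eps B t eta eta' : R) :
  measurable S -> S `<=` D -> measurable S' -> S' `<=` E ->
  0 <= eps -> 0 <= B -> 0 < t ->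
  fine (mu S) <= eta -> fine (mu' S') <= eta' ->
  (forall x y, E x -> ~ S' x -> D y -> Normc.normc (k x y) <= eps + B * \1_S y) ->
  (forall x y, S' x -> D y -> Normc.normc (k x y) <= B) ->
  (opnorm mu mu' D E A <= (Num.sqrt
     ((2 * (eps * (fine (mu D) + 1) + B * (t * eta + t^-1))) ^+ 2 * fine (mu' E) +
      (2 * (B * (fine (mu D) + 1))) ^+ 2 * eta'))%:E)%E.
Proof.
move=> mS SD mS' SE eps0 B0 t0 Seta Seta' kout kin.
apply: ge_ereal_sup => _ [g [Lg g1] <-].
have sg := L2norm_le1 mD Lg g1.
apply: (@L2norm_piecewise_le _ _ _ mu' E mE fE _ S') => //; first exact: mA.
- move=> x Ex Sx; rewrite Ak// /kernel_op.
  have [_] := normc_Cintegral_kernel_le mD fD (mk Ex) Lg mS SD eps0 B0 t0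
    (lexx _) Seta (fun y => @kout x y Ex Sx).
  move=> /le_trans; apply; rewrite ler_wpM2l// lerD// ler_wpM2l// ?lerD2l//.
  by rewrite ler_pdivrMr// mulVf ?gt_eqF.
- move=> x Sx; have Ex := SE _ Sx; rewrite Ak// /kernel_op.
  have [] := @normc_Cintegral_kernel_le _ _ _ mu D mD fD _ g set0 B 0 _ 0 1
    (mk Ex) Lg measurable0 (@sub0set _ _) B0 (lexx 0) ltr01 (lexx _).
  + by rewrite measure0.
  + by move=> y Dy; rewrite mul0r addr0 kin.
  move=> _ /le_trans; apply.
  by rewrite mul0r addr0 ler_wpM2l// ler_wpM2l// lerD2l.
Qed.

Lemma kernel_bounded_operator (B : R) :
  (forall x y, E x -> D y -> Normc.normc (k x y) <= B) ->
  bounded_operator mu mu' D E A.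
Proof.
move=> kB; pose B' := `|B|.
have B0 : 0 <= B' by exact: normr_ge0.
have kB' x y : E x -> D y -> Normc.normc (k x y) <= B'.
  by move=> Ex Dy; rewrite (le_trans (kB _ _ Ex Dy)) ?ler_norm.
have kbnd g x : L2 mu D g -> E x -> Cintegrable mu D (fun y => k x y * g y) /\
    Normc.normc (kernel_op k g x) <=
    2 * (B' * (fine (mu D) + \int[mu]_(y in D) (Normc.normc (g y) ^+ 2))).
  move=> Lg Ex.
  have [] := @normc_Cintegral_kernel_le _ _ _ mu D mD fD _ g set0 B' 0 _ 0 1
    (mk Ex) Lg measurable0 (@sub0set _ _) B0 (lexx 0) ltr01 (lexx _).
  + by rewrite measure0.
  + by move=> y Dy; rewrite mul0r addr0 kB'.
  by rewrite mul0r addr0; split.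
split.
- move=> g Lg; split; first exact: mA.
  apply: (@le_lt_trans _ _ _ _ _ (@L2norm_piecewise_le _ _ _ mu' E mE fE _ set0
    (2 * (B' * (fine (mu D) + \int[mu]_(y in D) (Normc.normc (g y) ^+ 2))))
    0 (fine (mu' E)) 0 (mA Lg) measurable0 (@sub0set _ _) _ _ _ _)) => //.
  + by rewrite measure0.
  + by move=> x Ex _; rewrite Ak//; case: (kbnd g x Lg Ex).
  + exact: ltry.
- move=> c g h Lg Lh; apply: aeW => x Ex.
  have Lgh := L2_linear mD fD c Lg Lh.
  rewrite !Ak// /kernel_op -CintegralZl//; last by case: (kbnd g x Lg Ex).
  rewrite -CintegralD//; first last.
  + by case: (kbnd h x Lh Ex).
  + by apply: CintegrableZl => //; case: (kbnd g x Lg Ex).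
  by apply: eq_Cintegral => y _; ring.
- apply: (@le_lt_trans _ _ _ _ _ (@opnorm_kernel_le set0 set0 B' 0 1 0 0
    measurable0 (@sub0set _ _) measurable0 (@sub0set _ _) B0 (lexx 0) ltr01 _ _ _ _)).
  + by rewrite measure0.
  + by rewrite measure0.
  + by move=> x y Ex _ Dy; rewrite mul0r addr0 kB'.
  + by [].
  + exact: ltry.
Qed.

End kernel_operator.

(** * Borel sets, measurable functions and null sets in R^d *)

Section rV_topology.
Variables (R : realType) (d : nat).
Local Notation V := 'rV[R]_d.
Implicit Types (x y : V) (U : set V).

Lemma rV_norm_ltP x (e : R) : 0 < e ->
  `|x| < e <-> forall i, `|x ord0 i| < e.
Proof.
move=> e0; rewrite (_ : `|x| = mx_norm x)// mx_normrE; split.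
  by move=> /bigmax_ltP[_ xe] i; exact: (xe (ord0, i)).
by move=> xe; apply/bigmax_ltP; split => // -[i j] _ /=; rewrite (ord1 i).
Qed.

Lemma rV_coord_le x i : `|x ord0 i| <= `|x|.
Proof.
rewrite leNgt; apply/negP => xi.
have [] := @rV_norm_ltP x `|x ord0 i|; first exact: le_lt_trans xi.
by move=> /(_ xi i); rewrite ltxx.
Qed.

Lemma rV_norm_le x (e : R) : 0 <= e ->
  (forall i, `|x ord0 i| <= e) -> `|x| <= e.
Proof.
move=> e0 xe; apply/ler_addgt0Pr => r r0; apply/ltW/rV_norm_ltP.
  by rewrite ltr_wpDl.
by move=> i; rewrite (le_lt_trans (xe i))// ltrDl.
Qed.

Lemma open_normP U : open U <->
  forall x, U x -> exists2 e : R, 0 < e & forall y, `|x - y| < e -> U y.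
Proof.
rewrite openE; split => oU x /oU.
  by move=> /nbhs_ballP[e /= e0 xe]; exists e => // y xy; apply: xe; rewrite -ball_normE.
move=> [e e0 xe]; apply/nbhs_ballP; exists e => //= y; rewrite -ball_normE.
exact: xe.
Qed.

Lemma rational_approximation x (e : R) : 0 < e ->
  exists q : 'rV[rat]_d, `|x - map_mx ratr q| < e.
Proof.
move=> e0.
have /choice[q xq] : forall i, exists r : rat, `|x ord0 i - ratr r| < e.
  move=> i; have /rat_in_itvoo[r] : x ord0 i - e < x ord0 i + e by lra.
  by rewrite in_itv/= => /andP[? ?]; exists r; rewrite ltr_norml; apply/andP; split; lra.
exists (\row_i q i); apply/rV_norm_ltP => // i.
by rewrite !mxE.
Qed.

Lemma measurable_coord_preimage (i : 'I_d) (A : set R) : measurable A ->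
  measurable [set x : V | A (x ord0 i)].
Proof.
move=> mA; rewrite -[X in measurable X]setTI.
by have := @measurable_coord _ R d i; apply.
Qed.

Lemma measurable_norm_ball x (e : R) : 0 < e ->
  measurable [set y : V | `|x - y| < e].
Proof.
move=> e0.
rewrite (_ : [set y | _] = \bigcap_(i in [set: 'I_d])
    [set y : V | `]x ord0 i - e, x ord0 i + e[%classic (y ord0 i)]).
  apply: fin_bigcap_measurable => // i _.
  by apply: measurable_coord_preimage; exact: measurable_itv.
apply/seteqP; split => y /=.
  move=> /(rV_norm_ltP _ e0) xy i _ /=; rewrite in_itv/=.
  by have := xy i; rewrite !mxE ltr_norml => /andP[? ?]; apply/andP; split; lra.
move=> xy; apply/(rV_norm_ltP _ e0) => i; have := xy i Logic.I.
by rewrite /= in_itv/= !mxE ltr_norml => /andP[? ?]; apply/andP; split; lra.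
Qed.

(** The product sigma-algebra contains the open sets because the balls of the
    sup norm are boxes, and those with rational centre and radius 1/(n+1) form
    a countable basis. *)
Lemma open_measurable_rV U : open U -> measurable U.
Proof.
move=> /open_normP oU.
pose box (p : 'rV[rat]_d * nat) := [set y : V | `|map_mx ratr p.1 - y| < p.2.+1%:R^-1].
rewrite (_ : U = \bigcup_p (if `[< box p `<=` U >] then box p else set0)).
  apply: countable_bigcupT_measurable => [|p]; first exact: countableP.
  by case: ifP => // _; apply: measurable_norm_ball.
apply/seteqP; split => [x /[dup] Ux /oU[e e0 xU]|x [p _]]; last first.
  by case: ifPn => // /asboolP; exact.
have [n _ /(_ n (leqnn n))/= ne] :=
  @near_infty_natSinv_lt R (PosNum (divr_gt0 e0 (ltr0n R 2))).
have n0 : 0 < n.+1%:R^-1 :> R by rewrite invr_gt0.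
have [q xq] := rational_approximation x n0.
exists (q, n) => //; rewrite asboolT /box /=; first by rewrite distrC.
move=> y qy; apply: xU.
rewrite -(subrK (map_mx ratr q) x) -addrA.
rewrite (le_lt_trans (ler_normD _ _))//=.
by rewrite [ltRHS](splitr e) ltrD// (lt_trans _ ne).
Qed.

Lemma open_measurable_fun_rV U (h : V -> R) : open U ->
  (forall x, U x -> forall e, 0 < e -> exists2 r : R, 0 < r &
    forall y, U y -> `|x - y| < r -> `|h x - h y| < e) ->
  measurable_fun U h.
Proof.
move=> /open_normP oU ch.
apply: (measurability (@RGenOInfty.G R)); first exact: RGenOInfty.measurableE.
move=> _ [_ [a ->] <-]; apply: open_measurable_rV; apply/open_normP => x [Ux].
rewrite /= in_itv/= andbT => ahx.
have hxa : 0 < h x - a by rewrite subr_gt0.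
have [r r0 xr] := ch x Ux _ hxa; have [e e0 xe] := oU x Ux.
exists (Num.min r e) => [|y]; first by rewrite lt_min r0.
rewrite lt_min => /andP[xyr xye]; have Uy := xe _ xye.
split => //; rewrite /= in_itv/= andbT.
by have := xr _ Uy xyr; rewrite ltr_norml => /andP[? ?]; lra.
Qed.

Lemma open_cmeasurable_rV (U : set V) (h : V -> R[i]) : open U ->
  (forall x, U x -> forall e, 0 < e -> exists2 r : R, 0 < r &
    forall y, U y -> `|x - y| < r -> Normc.normc (h x - h y) < e) ->
  cmeasurable_fun U h.
Proof.
move=> oU ch; split; apply: open_measurable_fun_rV => // x Ux e e0.
  have [r r0 xr] := ch x Ux e e0; exists r => // y Uy xy.
  rewrite (le_lt_trans _ (xr y Uy xy))// (le_trans _ (normr_Re_le _))//.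
  by case: (h x) (h y) => ? ? [].
have [r r0 xr] := ch x Ux e e0; exists r => // y Uy xy.
rewrite (le_lt_trans _ (xr y Uy xy))// (le_trans _ (normr_Im_le _))//.
by case: (h x) (h y) => ? ? [].
Qed.

Lemma bounded_set_normP (U : set V) : bounded_set U ->
  exists2 M : R, 0 < M & forall x, U x -> `|x| <= M.
Proof.
move=> [M [_ UM]]; exists (`|M| + 1); first by rewrite ltr_wpDl.
by apply: UM; rewrite (le_lt_trans (ler_norm M))// ltrDl.
Qed.

End rV_topology.

Section rV_measure.
Variables (R : realType) (d : nat).
Local Notation V := 'rV[R]_d.
Local Notation mu := (@lebesgue_rV R d).
Implicit Types (Y : set V) (l : R).

Lemma bounded_lebesgue_rV_lty Y : bounded_set Y -> measurable Y -> (mu Y < +oo)%E.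
Proof.
move=> /bounded_set_normP[M M0 YM] mY.
pose I (i : 'I_d) := `[- M, M]%classic : set R.
have mI i : measurable (I i) by exact: measurable_itv.
have mB : measurable [set x : V | forall i, I i (x ord0 i)].
  rewrite (_ : [set x : V | _] = \bigcap_(i in [set: 'I_d])
      [set x : V | I i (x ord0 i)]).
    by apply: fin_bigcap_measurable => // i _; exact: measurable_coord_preimage.
  by apply/seteqP; split=> x /= Ix i => [_|]; exact: Ix.
have YB : Y `<=` [set x : V | forall i, I i (x ord0 i)].
  move=> x Yx i; rewrite /I /= in_itv/= -ler_norml.
  by rewrite (le_trans (rV_coord_le _ _))// YM.
apply: (le_lt_trans (le_measure mu (mem_set mY) (mem_set mB) YB)).
rewrite [ltLHS](lebesgue_rV_box mI).
have If : lebesgue_measure (`[- M, M]%classic : set R) \is a fin_num.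
  by rewrite lebesgue_measure_itv /= -EFinB; case: ifP.
rewrite (eq_bigr (fun=> (fine (lebesgue_measure (`[- M, M]%classic : set R)))%:E)).
  by rewrite prodEFin ltry.
by move=> i _; rewrite fineK.
Qed.

Lemma measurable_hyperplane (i : 'I_d) (c : R) : measurable [set x : V | x ord0 i = c].
Proof. exact: (measurable_coord_preimage i (measurable_set1 c)). Qed.

Lemma hyperplane_null (i : 'I_d) (c : R) : mu [set x : V | x ord0 i = c] = 0%E.
Proof.
pose A (j : 'I_d) := if j == i then [set c] else [set: R].
have mA j : measurable (A j) by rewrite /A; case: ifP.
rewrite (_ : [set x : V | _] = [set x : V | forall j, A j (x ord0 j)]).
  rewrite (lebesgue_rV_box mA) (bigD1 i)//= /A eqxx.
  by rewrite lebesgue_measure_set1 mul0e.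
apply/seteqP; split => x /=; rewrite /A.
  by move=> xi j; case: eqP => [->|].
by move=> /(_ i); rewrite eqxx.
Qed.

(** For [l > 0], the points lying in none of the open cubes of side [l] centred
    at the points of the lattice of mesh [l]. *)
Definition cell_faces l : set V :=
  \bigcup_(p : 'I_d * int) [set x : V | x ord0 p.1 = l * (p.2%:~R + 2^-1)].

Lemma measurable_cell_faces l : measurable (cell_faces l).
Proof.
apply: countable_bigcupT_measurable => [|p]; first exact: countableP.
exact: measurable_hyperplane.
Qed.

Lemma cell_faces_null l : mu (cell_faces l) = 0%E.
Proof.
pose F (k : nat) : set V := if @choice.unpickle ('I_d * int : countType)%type k is Some p
  then [set x : V | x ord0 p.1 = l * (p.2%:~R + 2^-1)] else set0.
have : mu.-negligible (\bigcup_k F k).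
  apply: negligible_bigcup => k; rewrite /F; case: choice.unpickle => [p|].
    apply/negligibleP; last exact: hyperplane_null.
    exact: measurable_hyperplane.
  exact: negligible_set0.
move=> nF; apply/negligibleP; first exact: measurable_cell_faces.
apply: negligibleS nF => x [p _ xp].
by exists (choice.pickle p) => //; rewrite /F choice.pickleK.
Qed.

End rV_measure.

(** * The part of an open set missed by the interior cubes *)

Section gap.
Variables (R : realType) (d : nat).
Local Notation V := 'rV[R]_d.
Local Notation mu := (@lebesgue_rV R d).
Implicit Types (Y : set V) (l : R).

Definition lattice_cell_union l Y : set V :=
  \bigcup_(y in lattice_int l Y) cube l y.

Definition gap l Y : set V := Y `\` lattice_cell_union l Y.

Definition eroded Y (r : R) : set V :=
  [set x | forall y, `|x - y| < r -> Y y].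

Lemma measurable_setD_eroded Y r : open Y -> measurable (Y `\` eroded Y r).
Proof.
move=> oY; rewrite (_ : Y `\` _ = Y `&` \bigcup_(y in ~` Y) [set x | `|y - x| < r]).
  apply: measurableI; first exact: open_measurable_rV.
  apply: open_measurable_rV; apply: bigcup_open => y _.
  apply/open_normP => x /= xl; exists (r - `|y - x|) => [|z xz].
    by rewrite subr_gt0.
  by rewrite -[y](subrK x) -addrA (le_lt_trans (ler_normD _ _))//; lra.
apply/seteqP; split => x [Yx].
  move=> /existsNP[y /not_implyP[xy Yy]]; split => //.
  by exists y => //=; rewrite distrC.
by move=> [y Yy /= yx]; split => // /(_ y); rewrite distrC => /(_ yx).
Qed.

Lemma open_cube l (y : V) : open (cube l y).
Proof.
apply/open_normP => x; rewrite /cube /= => xl.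
exists (l / 2 - `|x - y|) => [|z xz]; first by rewrite subr_gt0.
rewrite -[z](subrK x) -addrA (le_lt_trans (ler_normD _ _))// distrC; lra.
Qed.

Lemma measurable_gap l Y : open Y -> measurable (gap l Y).
Proof.
move=> oY; apply: measurableD; first exact: open_measurable_rV.
by apply: open_measurable_rV; apply: bigcup_open => y _; exact: open_cube.
Qed.

Lemma nearest_lattice_point l (x : V) : 0 < l ->
  exists n : 'rV[int]_d, forall i, `|x ord0 i - l * (n ord0 i)%:~R| <= l / 2.
Proof.
move=> l0; exists (\row_i Num.floor (x ord0 i / l + 2^-1)) => i; rewrite mxE.
set t := x ord0 i; have := floor_itv (t / l + 2^-1).
set n := Num.floor _; rewrite intrD => /andP[n0 n1].
rewrite (_ : t = l * (t / l)); last by rewrite mulrC divfK ?gt_eqF.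
rewrite -mulrBr normrM gtr0_norm// ler_pM2l// ler_norml.
by apply/andP; split; lra.
Qed.

(** A point of [Y] whose [r]-ball stays in [Y] is within [l / 2] of a lattice
    point, and for [l < r] the cube around that lattice point is contained in
    the ball. Hence the cube is interior, and the point can only escape it by
    lying on a face. *)
Lemma gap_sub l Y (r : R) : 0 < l -> l < r ->
  gap l Y `<=` (Y `\` eroded Y r) `|` cell_faces l.
Proof.
move=> l0 lr x [Yx xcells].
have [Ex|] := pselect (eroded Y r x); last by left.
right; have [m xm] := nearest_lattice_point x l0.
pose y : V := l *: map_mx intr m.
have yE i : y ord0 i = l * (m ord0 i)%:~R by rewrite !mxE.
have xy : `|x - y| <= l / 2.
  apply: rV_norm_le => [|i]; first by rewrite divr_ge0// ltW.
  by rewrite mxE [(- y) _ _]mxE yE.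
have yint : lattice_int l Y y.
  split; first split.
  - by apply: Ex; rewrite (le_lt_trans xy)//; lra.
  - by exists m.
  - move=> z; rewrite /cube /= => zy; apply: Ex.
    rewrite -[x](subrK y) -addrA (le_lt_trans (ler_normD _ _))//.
    by rewrite (distrC y z); lra.
have xncube : ~ cube l y x by move=> xc; apply: xcells; exists y.
have [i xi] : exists i, ~ `|x ord0 i - y ord0 i| < l / 2.
  apply/existsNP => xi; apply: xncube; apply/rV_norm_ltP => [|i].
    by rewrite divr_gt0.
  by rewrite mxE [(- y) _ _]mxE.
have {}xi : `|x ord0 i - y ord0 i| = l / 2.
  apply/eqP; rewrite eq_le (leNgt (l / 2)) (introN idP xi) andbT.
  by rewrite yE.
move: xi; rewrite yE => /eqP; rewrite eqr_norml => /andP[/orP[] /eqP xi _].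
  by exists (i, m ord0 i) => //=; lra.
by exists (i, m ord0 i - 1) => //=; rewrite intrB; lra.
Qed.

(** As [Y] is open, the sets [Y `\` eroded Y r] decrease to the empty set as [r]
    tends to 0, so their measures tend to 0 by continuity from above; the faces
    are negligible. *)
Lemma gap_measure_small Y (eta : R) : bounded_set Y -> open Y -> 0 < eta ->
  \forall l \near 0^'+, fine (mu (gap l Y)) <= eta.
Proof.
move=> bY oY eta0; have mY := open_measurable_rV oY.
have Yfin := bounded_lebesgue_rV_lty bY mY.
pose F (n : nat) := Y `\` eroded Y n.+1%:R^-1.
have mF n : measurable (F n) by exact: measurable_setD_eroded.
have cap0 : \bigcap_n F n = set0.
  apply/seteqP; split => x //= xn; have [Yx _] := xn 0%N Logic.I.
  have [e e0 xe] := (open_normP Y).1 oY x Yx.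
  have [n _ /(_ n (leqnn n))/= ne] := @near_infty_natSinv_lt R (PosNum e0).
  have [_] := xn n Logic.I; apply=> y xy; apply: xe.
  exact: lt_trans ne.
have cvgmu : (mu \o F) x @[x --> \oo] --> 0%E.
  have <- : mu (\bigcap_n F n) = 0%E by rewrite cap0 measure0.
  apply: nonincreasing_cvg_mu; [|exact: mF|by rewrite cap0|].
    by apply: (le_lt_trans _ Yfin); apply: le_measure; rewrite ?inE//; exact: subDsetl.
  move=> n m nm; apply/subsetPset => x [Yx nE]; split => // mE; apply: nE => y xy.
  by apply: mE; rewrite (lt_le_trans xy)// lef_pV2 ?posrE ?ltr0n// ler_nat.
have nb : nbhs 0%E [set x : \bar R | x < eta%:E]%E.
  by apply: open_nbhs_nbhs; split; [exact: open_ereal_lt_ereal|rewrite /= lte_fin].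
have [n _ /(_ n (leqnn n)) /= nsmall] := cvgmu _ nb.
near=> l.
have l0 : 0 < l by near: l; exact: nbhs_right_gt.
have ln : l < n.+1%:R^-1 by near: l; apply: nbhs_right_lt; rewrite invr_gt0.
rewrite -lee_fin fineK; last first.
  rewrite ge0_fin_numE// (le_lt_trans _ Yfin)//.
  by apply: le_measure; rewrite ?inE//; [exact: measurable_gap|exact: subDsetl].
apply/ltW; apply: le_lt_trans nsmall.
rewrite -(measureU0 (mF n) (measurable_cell_faces l) (cell_faces_null d l)).
apply: le_measure; rewrite ?inE; [exact: measurable_gap| |exact: gap_sub].
by apply: measurableU => //; exact: measurable_cell_faces.
Unshelve. all: by end_near. Qed.

End gap.

(** * The lattice, the embedding and its adjoint *)

Section lattice.
Variables (R : realType) (d : nat).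
Local Notation V := 'rV[R]_d.
Implicit Types (Y : set V) (l : R).

Lemma finite_lattice l Y : 0 < l -> bounded_set Y -> finite_set (lattice l Y).
Proof.
move=> l0 /bounded_set_normP[M M0 YM].
pose N := (Num.bound (M / l)).
pose F (k : {ffun 'I_d -> 'I_(N + N).+1}) : V :=
  l *: map_mx intr (\row_i ((k i)%:Z - N%:Z)).
apply: (@sub_finite_set _ _ (range F)); last first.
  exact/finite_image/finite_finset.
move=> y [Yy [n _ nE]]; subst y.
have nN i : (`|n ord0 i| <= N)%N.
  have /(le_trans (rV_coord_le _ i)) := YM _ Yy.
  rewrite !mxE normrM gtr0_norm// -ler_pdivlMl// mulrC => nM.
  rewrite -(@ler_nat R) natr_absz intr_norm (le_trans nM)// ltW// /N.
  by apply: archi_boundP; rewrite divr_ge0// ltW.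
(* The coordinates of n lie between - N and N, hence the shift by N. *)
exists [ffun i => inord (absz (n ord0 i + N%:Z))] => //; rewrite /F.
congr (_ *: map_mx _ _); apply/rowP => i; rewrite mxE ffunE inordK.
  by have := nN i; rewrite [n 0 i](_ : _ = n ord0 i)//; lia.
by have := nN i; lia.
Qed.

(** The sums over the lattice are indexed by a set; the lattice being finite,
    they all are sums over one sequence, to which the linearity lemmas apply. *)
Lemma lattice_enumeration l Y : 0 < l -> bounded_set Y ->
  exists s : seq (lattice l Y), [/\ uniq s, forall y, y \in s &
    forall (U : nmodType) (F : lattice l Y -> U), \sum_(y \in [set: lattice l Y]) F y =
      \sum_(y <- s) F y].
Proof.
move=> l0 bY; have fL : finite_set [set: lattice l Y].
  by rewrite (eq_finite_set (card_setT _)); exact: finite_lattice.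
exists (fset_set [set: lattice l Y]); split => [|y|U F].
- exact: fset_uniq.
- by rewrite in_fset_set// inE.
- by rewrite fsbig_finite.
Qed.

Lemma lattice_cubes_disjoint l Y (x y : lattice l Y) (t : V) : 0 < l ->
  cube l (val x) t -> cube l (val y) t -> x = y.
Proof.
move=> l0; case: x y => [x xL] [y yL] /= tx ty; apply/val_inj => /=.
have [_ [n _ nE]] := set_mem xL; have [_ [m _ mE]] := set_mem yL.
have : `|x - y| < l.
  rewrite -[x](subrK t) -addrA (le_lt_trans (ler_normD _ _))// distrC.
  by move: tx ty; rewrite /cube /=; lra.
rewrite -nE -mE -scalerBr normrZ gtr0_norm// -ltr_pdivlMl// mulVf ?gt_eqF//.
move=> /(rV_norm_ltP _ ltr01) nm; congr (_ *: map_mx _ _); apply/rowP => i.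
have := nm i; rewrite !mxE -intrB -intr_norm ltrz1 ltr_norml.
by rewrite [n 0 i](_ : _ = n ord0 i)// [m 0 i](_ : _ = m ord0 i)//; lia.
Qed.

End lattice.

Section embedding.
Variables (R : realType) (d : nat).
Local Notation V := 'rV[R]_d.
Local Notation mu := (@lebesgue_rV R d).
Variables (l : R) (Y : set V).
Hypotheses (l0 : 0 < l) (bY : bounded_set Y) (oY : open Y).
Implicit Types (a : ell2 l Y) (g : V -> R[i]).

Let mY : measurable Y := open_measurable_rV oY.
Let fY : (mu Y < +oo)%E := bounded_lebesgue_rV_lty bY mY.

Lemma embedding_cube a (y : lattice l Y) t :
  lattice_int l Y (val y) -> cube l (val y) t ->
  embedding l Y a t = a y * (l `^ (- (d%:R / 2)))%:C%C.
Proof.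
move=> yint ty; have [s [us ss sE]] := lattice_enumeration l0 bY.
rewrite /embedding sE (bigD1_seq y)//= big1 ?addr0.
  by rewrite /sample_basis !mem_set.
move=> z zy; rewrite /sample_basis; case: ifPn => [/andP[_ /set_mem tz]|].
  by move: zy; rewrite (lattice_cubes_disjoint l0 tz ty) eqxx.
by rewrite mulr0.
Qed.

Lemma embedding_out a t : ~ lattice_cell_union l Y t -> embedding l Y a t = 0.
Proof.
move=> tY; have [s [_ _ sE]] := lattice_enumeration l0 bY.
rewrite /embedding sE big1// => z _; rewrite /sample_basis.
case: ifPn => [/andP[/set_mem zint /set_mem tz]|]; last by rewrite mulr0.
by exfalso; apply: tY; exists (val z).
Qed.

Lemma measurable_sample_basis D (y : lattice l Y) :
  cmeasurable_fun D (sample_basis y : V -> R[i]).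
Proof.
rewrite /sample_basis; case: (val y \in _) => /=; last exact: cmeasurable_cst.
by apply: cmeasurable_if; apply: open_measurable_rV; exact: open_cube.
Qed.

Lemma measurable_embedding D a : cmeasurable_fun D (embedding l Y a).
Proof.
have [s [_ _ sE]] := lattice_enumeration l0 bY.
rewrite /embedding; under eq_fun do rewrite sE.
apply: cmeasurable_fun_sum => y; apply: cmeasurable_funM.
  exact: cmeasurable_cst.
exact: measurable_sample_basis.
Qed.

Lemma conjc_sample_basis (y : lattice l Y) t :
  conjc (sample_basis y t) = sample_basis y t :> R[i].
Proof. by rewrite /sample_basis; case: ifP => _; rewrite ?conjc_real ?conjc0. Qed.

Lemma Cintegrable_sample_basis (y : lattice l Y) g : L2 mu Y g ->
  Cintegrable mu Y (fun t => sample_basis y t * g t).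
Proof.
move=> Lg; pose c := l `^ (- (d%:R / 2)).
have c0 : 0 <= c by exact: powR_ge0.
have [] := @normc_Cintegral_kernel_le _ _ _ mu Y mY fY (sample_basis y) g set0 c 0
  _ 0 1 (measurable_sample_basis Y y) Lg measurable0 (@sub0set _ _) c0 (lexx 0)
  ltr01 (lexx _) => //.
  by rewrite measure0.
move=> t _; rewrite mul0r addr0 /sample_basis; case: ifP => _.
  by rewrite /= expr0n/= addr0 sqrtr_sqr ger0_norm.
by rewrite Normc.normc0.
Qed.

(** The right-hand side satisfies the adjoint relation by linearity of the
    integral. Testing any adjoint against the indicator of a single lattice point
    recovers its values on L^2, so the chosen adjoint is this one. *)
Lemma adjoint_embedding g : L2 mu Y g -> adjoint (embedding l Y) g =
  fun y => Cintegral mu Y (fun t => sample_basis y t * g t).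
Proof.
move=> Lg; have [s [us ss sE]] := lattice_enumeration l0 bY.
pose S g (y : lattice l Y) := Cintegral mu Y (fun t => sample_basis y t * g t).
have Sadj : is_adjoint (embedding l Y) S.
  move=> a h Lh; rewrite /ell2dot sE /L2dot.
  have int_conj (y : lattice l Y) : Cintegrable mu Y (fun t => conjc (sample_basis y t * h t)).
    exact: (Cintegrable_conj mY (Cintegrable_sample_basis y Lh)).
  transitivity (Cintegral mu Y (fun t => \sum_(y <- s) a y * conjc (sample_basis y t * h t))).
    apply: eq_Cintegral => t _; rewrite /embedding sE mulr_suml.
    by apply: eq_bigr => y _; rewrite conjcM conjc_sample_basis mulrA.
  rewrite Cintegral_sum//; last by move=> y; exact: CintegrableZl.
  apply: eq_bigr => y _; rewrite CintegralZl// Cintegral_conj//.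
  exact: Cintegrable_sample_basis.
have adjP : is_adjoint (embedding l Y) (adjoint (embedding l Y)).
  by apply: (@xgetPex _ _ [set S | is_adjoint (embedding l Y) S]); exists S.
apply/funext => y; pose a : ell2 l Y := fun z => (z == y)%:R.
have dotE b : ell2dot a b = conjc (b y).
  rewrite /ell2dot sE (bigD1_seq y)//= /a eqxx mul1r big1 ?addr0// => z /negPf ->.
  by rewrite mul0r.
apply: (can_inj (@conjcK R)).
by rewrite -/(S g y) -!dotE -adjP// -Sadj.
Qed.

End embedding.

(** * Discretization of a uniformly continuous kernel *)

(** Choice of the error parameters that makes the bound of [opnorm_kernel_le] at
    most [e]: first [t] so large that the term in 1/t is small, then [eta] so
    small that t * eta is. *)
Lemma error_parameters (R : rcfType) (m m' B e : R) : 0 <= m -> 0 <= m' -> 0 <= B -> 0 < e ->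
  exists eps eta eta' t, [/\ 0 < eps, 0 < eta, 0 < eta', 0 < t &
    Num.sqrt ((2 * (eps * (m + 1) + B * (t * eta + t^-1))) ^+ 2 * m' +
      (2 * (B * (m + 1))) ^+ 2 * eta') <= e].
Proof.
move=> m0 m'0 B0 e0.
have m1 : 0 < m + 1 by lra.
have B1 : 0 < B + 1 by lra.
pose al := e / (2 * (m' + 1)).
have al0 : 0 < al by rewrite divr_gt0// mulr_gt0//; lra.
pose t := 6 * (B + 1) / al; have t0 : 0 < t by rewrite divr_gt0// mulr_gt0.
pose C := (2 * (B * (m + 1))) ^+ 2; have C0 : 0 <= C by rewrite sqr_ge0.
exists (al / (6 * (m + 1))), (t^-1 ^+ 2), (e ^+ 2 / (2 * (C + 1))), t; split => //.
- by rewrite divr_gt0// mulr_gt0.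
- by rewrite exprn_gt0// invr_gt0.
- by rewrite divr_gt0 ?exprn_gt0// mulr_gt0//; lra.
apply: (@le_trans _ _ (Num.sqrt (e ^+ 2))); last first.
  by rewrite sqrtr_sqr ger0_norm// ltW.
apply: ler_wsqrtr; rewrite -/C.
have -> : al / (6 * (m + 1)) * (m + 1) = al / 6 by field; lra.
have -> : t * t^-1 ^+ 2 = t^-1 by field; rewrite gt_eqF.
have tE : t^-1 = al / (6 * (B + 1)) by rewrite /t; field; apply/andP; split; lra.
have Bt : B * (t^-1 + t^-1) <= al / 3.
  rewrite tE (_ : B * _ = (al / 3) * (B / (B + 1))); last by field; lra.
  by rewrite ler_piMr//; [rewrite divr_ge0// ltW|rewrite ler_pdivrMr//; lra].
have Bt0 : 0 <= B * (t^-1 + t^-1).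
  by rewrite mulr_ge0// addr_ge0// invr_ge0 ltW.
have main : (2 * (al / 6 + B * (t^-1 + t^-1))) ^+ 2 <= al ^+ 2.
  by rewrite lerXn2r ?nnegrE//; lra.
rewrite (@le_trans _ _ (al ^+ 2 * m' + C * (e ^+ 2 / (2 * (C + 1)))))//.
  by rewrite lerD2r ler_wpM2r.
have h1 : al ^+ 2 * m' <= e ^+ 2 / 2.
  rewrite (_ : al ^+ 2 * m' = (e ^+ 2 / 2) * (m' / (2 * (m' + 1) ^+ 2))); last first.
    by rewrite /al; field; lra.
  rewrite ler_piMr ?divr_ge0 ?sqr_ge0// ler_pdivrMr; first by nra.
  by rewrite mulr_gt0// exprn_gt0//; lra.
have h2 : C * (e ^+ 2 / (2 * (C + 1))) <= e ^+ 2 / 2.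
  rewrite (_ : C * _ = (e ^+ 2 / 2) * (C / (C + 1))); last by field; lra.
  by rewrite ler_piMr ?divr_ge0 ?sqr_ge0// ler_pdivrMr; lra.
lra.
Qed.

Section kernel_discretization.
Variables (R : realType) (d : nat).
Local Notation V := 'rV[R]_d.
Local Notation mu := (@lebesgue_rV R d).
Variables (X Y : set V) (k : V -> V -> R[i]).
Hypotheses (bX : bounded_set X) (oX : open X) (bY : bounded_set Y) (oY : open Y).

Let mX : measurable X := open_measurable_rV oX.
Let fX : (mu X < +oo)%E := bounded_lebesgue_rV_lty bX mX.
Let mY : measurable Y := open_measurable_rV oY.
Let fY : (mu Y < +oo)%E := bounded_lebesgue_rV_lty bY mY.

Definition disc_kernel_op (l : R) (a : ell2 l Y) : ell2 l X :=
  fun x => \sum_(y \in [set: lattice l Y]) k (val x) (val y) * a y.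

Definition discretization (l : R) (g : V -> R[i]) (x : V) : R[i] :=
  (l ^+ d)%:C%C * embedding l X (disc_kernel_op (adjoint (embedding l Y) g)) x.

(** The kernel that equals [k x0 y0] on each product of the interior cubes
    around [x0] and [y0], and 0 elsewhere; see [step_kernel_cubes]. Writing it
    with the embeddings makes [discretizationE] a matter of linearity. *)
Definition step_kernel (l : R) (x y : V) : R[i] :=
  (l ^+ d)%:C%C *
  embedding l X (fun x0 => embedding l Y (fun y0 => k (val x0) (val y0)) y) x.

(** The discretized operator is itself an integral operator: the adjoint
    integrates [g] against the basis functions, and the finite sums over the two
    lattices can be moved under the integral. *)
Lemma discretizationE (l : R) g x : 0 < l -> L2 mu Y g ->
  discretization l g x = kernel_op mu Y (step_kernel l) g x.
Proof.
move=> l0 Lg.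
have [sX [_ _ sXE]] := lattice_enumeration l0 bX.
have [sY [_ _ sYE]] := lattice_enumeration l0 bY.
pose c (x0 : lattice l X) (y0 : lattice l Y) : R[i] :=
  (l ^+ d)%:C%C * (k (val x0) (val y0) * sample_basis x0 x).
have iY (x0 : lattice l X) (y0 : lattice l Y) :
    Cintegrable mu Y (fun y => c x0 y0 * (sample_basis y0 y * g y)).
  by apply: CintegrableZl => //; exact: Cintegrable_sample_basis.
transitivity (Cintegral mu Y (fun y =>
    \sum_(x0 <- sX) \sum_(y0 <- sY) c x0 y0 * (sample_basis y0 y * g y))); last first.
  apply: eq_Cintegral => y _.
  rewrite /step_kernel /embedding sXE -mulrA mulr_suml mulr_sumr.
  apply: eq_bigr => x0 _; rewrite sYE !mulr_suml mulr_sumr.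
  by apply: eq_bigr => y0 _; rewrite /c; ring.
rewrite Cintegral_sum//; last by move=> x0; exact: Cintegrable_sum.
rewrite /discretization /embedding sXE mulr_sumr; apply: eq_bigr => x0 _.
rewrite Cintegral_sum// /disc_kernel_op sYE mulr_suml mulr_sumr.
apply: eq_bigr => y0 _; rewrite CintegralZl//; last exact: Cintegrable_sample_basis.
by rewrite adjoint_embedding// /c; ring.
Qed.

(* The factor l^d compensates exactly for the two normalizations l^(-d/2). *)
Let scale_sample_basis (l : R) : 0 < l ->
  l ^+ d * (l `^ (- (d%:R / 2)) * l `^ (- (d%:R / 2))) = 1.
Proof.
move=> l0; rewrite -powRD; last by apply/implyP => _; rewrite gt_eqF.
rewrite -opprD -splitr powRN powR_mulrn ?ltW// mulfV//.
by rewrite gt_eqF// exprn_gt0.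
Qed.

Lemma step_kernel_cubes (l : R) (x0 : lattice l X) (y0 : lattice l Y) x y : 0 < l ->
  lattice_int l X (val x0) -> cube l (val x0) x ->
  lattice_int l Y (val y0) -> cube l (val y0) y ->
  step_kernel l x y = k (val x0) (val y0).
Proof.
move=> l0 x0int x0x y0int y0y; rewrite /step_kernel.
rewrite (embedding_cube l0 bX _ x0int x0x) (embedding_cube l0 bY _ y0int y0y).
rewrite -mulrA -rmorphM mulrCA -rmorphM -[RHS]mulr1; congr (_ * _).
by rewrite scale_sample_basis.
Qed.

Lemma step_kernel_outl (l : R) x y : 0 < l ->
  ~ lattice_cell_union l X x -> step_kernel l x y = 0.
Proof. by move=> l0 xX; rewrite /step_kernel embedding_out// mulr0. Qed.

Lemma step_kernel_outr (l : R) x y : 0 < l ->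
  ~ lattice_cell_union l Y y -> step_kernel l x y = 0.
Proof.
move=> l0 yY; rewrite /step_kernel.
have -> : (fun x0 : lattice l X => embedding l Y (fun y0 => k (val x0) (val y0)) y) =
    fun=> 0 by apply/funext => x0; exact: embedding_out.
have [s [_ _ sE]] := lattice_enumeration l0 bX.
by rewrite /embedding sE big1 ?mulr0// => x0 _; rewrite mul0r.
Qed.

Lemma measurable_step_kernel (l : R) x : 0 < l ->
  cmeasurable_fun Y (step_kernel l x).
Proof.
move=> l0; have [s [_ _ sE]] := lattice_enumeration l0 bX.
rewrite /step_kernel; apply: cmeasurable_funM; first exact: cmeasurable_cst.
under eq_fun do rewrite /embedding sE.
apply: cmeasurable_fun_sum => x0; apply: cmeasurable_funM.
  exact: measurable_embedding.
exact: cmeasurable_cst.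
Qed.

Variable M : R.
Hypothesis kM : forall x y, X x -> Y y -> Normc.normc (k x y) <= M.
Hypothesis kU : forall e : R, 0 < e -> exists2 r : R, 0 < r &
  forall x x' y y', X x -> X x' -> Y y -> Y y' -> `|x - x'| < r -> `|y - y'| < r ->
  Normc.normc (k x y - k x' y') <= e.

Let M' := `|M|.
Let M'0 : 0 <= M'. Proof. exact: normr_ge0. Qed.
Let kM' x y : X x -> Y y -> Normc.normc (k x y) <= M'.
Proof. by move=> Xx Yy; rewrite (le_trans (kM Xx Yy)) ?ler_norm. Qed.

Let lattice_cell (l : R) (Z : set V) z : Z z -> ~ gap l Z z ->
  exists2 z0 : lattice l Z, lattice_int l Z (val z0) & cube l (val z0) z.
Proof.
move=> Zz zgap; have [z0 z0int z0z] : lattice_cell_union l Z z.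
  by apply: contrapT => zU; apply: zgap.
by exists (exist _ z0 (mem_set z0int.1)).
Qed.

(** On a product of interior cubes the uniform continuity of [k] applies, since
    each point is within [l / 2] of the centre of its cube; on the gaps the step
    kernel vanishes and only the bound on [k] remains. *)
Lemma step_kernel_close (e : R) : 0 < e -> \forall l \near 0^'+,
  (forall x y, X x -> ~ gap l X x -> Y y ->
     Normc.normc (step_kernel l x y - k x y) <= e + M' * \1_(gap l Y) y) /\
  (forall x y, gap l X x -> Y y -> Normc.normc (step_kernel l x y - k x y) <= M').
Proof.
move=> e0; have [r r0 kr] := kU e0; near=> l.
have l0 : 0 < l by near: l; exact: nbhs_right_gt.
have lr : l < r by near: l; exact: nbhs_right_lt.
split=> x y => [Xx xgap Yy|[Xx xU] Yy]; last first.
  by rewrite step_kernel_outl// sub0r normcN kM'.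
have [x0 x0int x0x] := lattice_cell Xx xgap.
rewrite indicE; case: (boolP (y \in gap l Y)) => [/set_mem [_ yU]|/negP ygap].
  by rewrite step_kernel_outr// sub0r normcN mulr1 (le_trans (kM' Xx Yy))// lerDr ltW.
have [y0 y0int y0y] : exists2 y0 : lattice l Y, lattice_int l Y (val y0) & cube l (val y0) y.
  by apply: lattice_cell => // /mem_set.
rewrite (step_kernel_cubes l0 x0int x0x y0int y0y) mulr0 addr0.
move: x0x y0y; rewrite /cube /= => x0x y0y; apply: kr => //.
- exact: x0int.1.1.
- exact: y0int.1.1.
- by rewrite distrC; lra.
- by rewrite distrC; lra.
Unshelve. all: by end_near. Qed.

Let step_kernel_le (l : R) x y : 0 < l -> Normc.normc (step_kernel l x y) <= M'.
Proof.
move=> l0.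
have [[x0 x0int x0x]|xX] := pselect (lattice_cell_union l X x); last first.
  by rewrite step_kernel_outl// Normc.normc0.
have [[y0 y0int y0y]|yY] := pselect (lattice_cell_union l Y y); last first.
  by rewrite step_kernel_outr// Normc.normc0.
rewrite (@step_kernel_cubes l (exist _ x0 (mem_set x0int.1))
  (exist _ y0 (mem_set y0int.1)))//=.
by apply: kM'; [exact: x0int.1.1|exact: y0int.1.1].
Qed.

Let step_kernel_integrable (l : R) x g : 0 < l -> L2 mu Y g ->
  Cintegrable mu Y (fun y => step_kernel l x y * g y).
Proof.
move=> l0 Lg.
have [] := @normc_Cintegral_kernel_le _ _ _ mu Y mY fY _ g set0 M' 0 _ 0 1
  (measurable_step_kernel x l0) Lg measurable0 (@sub0set _ _) M'0 (lexx 0) ltr01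
  (lexx _) => //.
  by rewrite measure0.
by move=> y Yy; rewrite mul0r addr0 step_kernel_le.
Qed.

Let mk x : X x -> cmeasurable_fun Y (k x).
Proof.
move=> Xx; apply: open_cmeasurable_rV => // y Yy e e0.
have [r r0 kr] := kU (divr_gt0 e0 (ltr0n R 2)); exists r => // y' Yy' yy'.
by rewrite (le_lt_trans (kr x x y y' _ _ _ _ _ _))// ?subrr ?normr0//; lra.
Qed.

Let kernel_integrable x g : X x -> L2 mu Y g ->
  Cintegrable mu Y (fun y => k x y * g y).
Proof.
move=> Xx Lg.
have [] := @normc_Cintegral_kernel_le _ _ _ mu Y mY fY _ g set0 M' 0 _ 0 1
  (mk Xx) Lg measurable0 (@sub0set _ _) M'0 (lexx 0) ltr01 (lexx _) => //.
  by rewrite measure0.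
by move=> y Yy; rewrite mul0r addr0 kM'.
Qed.

(* The values depend continuously on x, by uniform continuity of the kernel. *)
Let measurable_kernel_op g : L2 mu Y g -> cmeasurable_fun X (kernel_op mu Y k g).
Proof.
move=> Lg; apply: open_cmeasurable_rV => // x Xx e e0.
set m := fine (mu Y) + \int[mu]_(y in Y) (Normc.normc (g y) ^+ 2).
have m0 : 0 <= m by rewrite addr_ge0 ?sqint_ge0 ?fine_ge0 ?measure_ge0.
have e'0 : 0 < e / (2 * (m + 1)) by rewrite divr_gt0// mulr_gt0// ltr_wpDl.
have [r r0 kr] := kU e'0; exists r => // x' Xx' xx'.
rewrite /kernel_op -[X in Normc.normc (_ + X)]mulN1r -CintegralZl//; last first.
  exact: kernel_integrable.
rewrite -CintegralD//; [|exact: kernel_integrable|]; last first.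
  by apply: CintegrableZl => //; exact: kernel_integrable.
rewrite (@eq_Cintegral _ _ _ mu Y _ (fun y => (k x y - k x' y) * g y)); last first.
  by move=> y _; ring.
have [] := @normc_Cintegral_kernel_le _ _ _ mu Y mY fY (fun y => k x y - k x' y) g
  set0 (e / (2 * (m + 1))) 0 _ 0 1 _ Lg measurable0 (@sub0set _ _) (ltW e'0) (lexx 0)
  ltr01 (lexx _).
- by apply: cmeasurable_funB; exact: mk.
- by rewrite measure0.
- by move=> y Yy; rewrite mul0r addr0; apply: kr => //; rewrite subrr normr0.
move=> _ /le_lt_trans; apply; rewrite mul0r addr0 -/m.
rewrite mulrA mulrC mulrA mulrA ltr_pdivrMr ?mulr_gt0 ?ltr_wpDl//; nra.
Qed.

Let kdiff (l : R) x y := step_kernel l x y - k x y.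

Let discretization_diffE (l : R) g x : 0 < l -> L2 mu Y g -> X x ->
  discretization l g x - kernel_op mu Y k g x = kernel_op mu Y (kdiff l) g x.
Proof.
move=> l0 Lg Xx; rewrite discretizationE// /kernel_op.
rewrite -[X in _ + X = _]mulN1r -CintegralZl//; last exact: kernel_integrable.
rewrite -CintegralD//; first last.
- by apply: CintegrableZl => //; exact: kernel_integrable.
- exact: step_kernel_integrable.
by apply: eq_Cintegral => y _; rewrite /kdiff; ring.
Qed.

(** The difference of the two operators has kernel [step_kernel l x y - k x y],
    so [opnorm_kernel_le] applies with the gaps of [X] and [Y] as exceptional
    sets; their measures vanish in the limit by [gap_measure_small]. *)
Theorem discretization_cvg :
  opnorm_cvg mu mu Y X 0^'+ discretization (kernel_op mu Y k).
Proof.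
have mdisc (l : R) g : 0 < l -> cmeasurable_fun X (discretization l g).
  move=> l0; apply: cmeasurable_funM; first exact: cmeasurable_cst.
  exact: measurable_embedding.
split.
- near=> l.
  have l0 : 0 < l by near: l; exact: nbhs_right_gt.
  apply: (@kernel_bounded_operator _ _ _ _ _ _ _ _ _ mY fY mX fX _
    (step_kernel l) _ _ _ M') => //.
  + by move=> g Lg x _; exact: discretizationE.
  + by move=> g Lg; exact: mdisc.
  + by move=> x _; exact: measurable_step_kernel.
  + by move=> x y _ _; exact: step_kernel_le.
- exact: (@kernel_bounded_operator _ _ _ _ _ _ _ _ _ mY fY mX fX _ k _ _ _ M).
set m := fine (mu Y); set m' := fine (mu X).
have m0 : 0 <= m by rewrite fine_ge0.
have m'0 : 0 <= m' by rewrite fine_ge0.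
pose err l := opnorm mu mu Y X (fun g x => discretization l g x - kernel_op mu Y k g x).
have err_small (e : R) : 0 < e -> \forall l \near 0^'+, (0 <= err l <= e%:E)%E.
  move=> e0; have [eps [eta [eta' [t [eps0 eta0 eta'0 t0 small]]]]] :=
    error_parameters m0 m'0 M'0 e0.
  near=> l.
  have l0 : 0 < l by near: l; exact: nbhs_right_gt.
  have [kout kin] : (forall x y, X x -> ~ gap l X x -> Y y ->
     Normc.normc (step_kernel l x y - k x y) <= eps + M' * \1_(gap l Y) y) /\
     (forall x y, gap l X x -> Y y -> Normc.normc (step_kernel l x y - k x y) <= M').
    by near: l; exact: step_kernel_close.
  apply/andP; split; first exact: opnorm_ge0.
  rewrite -lee_fin in small; rewrite (le_trans _ small)//.
  apply: (@opnorm_kernel_le _ _ _ _ _ mu mu Y X mY fY mX fX _ (kdiff l) _ _ _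
    (gap l Y) (gap l X)) => //.
  + by move=> g Lg x Xx; exact: discretization_diffE.
  + by move=> g Lg; apply: cmeasurable_funB; [exact: mdisc|exact: measurable_kernel_op].
  + by move=> x Xx; apply: cmeasurable_funB; [exact: measurable_step_kernel|exact: mk].
  + exact: measurable_gap.
  + exact: subDsetl.
  + exact: measurable_gap.
  + exact: subDsetl.
  + exact: ltW.
  + by near: l; exact: gap_measure_small.
  + by near: l; exact: gap_measure_small.
change (err l @[l --> 0^'+] --> 0%E); apply/fine_cvgP; split.
  near=> l; have /andP[n0 n1] : (0 <= err l <= 1%:E)%E by near: l; exact: err_small.
  by rewrite ge0_fin_numE// (le_lt_trans n1)// ltry.
apply/cvgrPdist_le => e e0; near=> l.
have /andP[n0 n1] : (0 <= err l <= e%:E)%E by near: l; exact: err_small.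
rewrite sub0r normrN ger0_norm ?fine_ge0// -lee_fin fineK//.
by rewrite ge0_fin_numE// (le_lt_trans n1)// ltry.
Unshelve. all: by end_near. Qed.

End kernel_discretization.

(** * Continuous functions on a compact set *)

Section compact_continuity.
Variables (R : realType) (d : nat).
Local Notation V := 'rV[R]_d.
Variables (K : set V) (f : V -> R[i]^o).
Hypotheses (cK : compact K) (cf : {within K, continuous f}).

Let continuous_normc x (e : R) : K x -> 0 < e -> exists2 r : R, 0 < r &
  forall y, K y -> `|x - y| < r -> Normc.normc (f x - f y) < e.
Proof.
move=> Kx e0; have /subspace_continuousP/(_ x Kx) fx := cf.
have e0' : (0 : R[i]) < e%:C%C by rewrite ltcR.
have [r /= r0 xr] : nbhs_ball (x : V) (fun y => K y -> `|f x - f y| < e%:C%C).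
  by apply/nbhs_ballP; exact: (@cvgr_dist_lt _ _ _ _ _ f (f x) fx _ e0').
exists r => // y Ky xy; have := xr y.
rewrite -ball_normE /= => /(_ xy Ky).
by rewrite normc_def ltcR; case: (f x - f y).
Qed.

Lemma compact_normc_bounded : exists M : R, forall x, K x -> Normc.normc (f x) <= M.
Proof.
have /compact_near_coveringP/(_ _ (+oo : set_system R)
  (fun M x => K x -> Normc.normc (f x) <= M)) := cK.
have cover x : K x -> \forall y \near x & M \near +oo, K y -> Normc.normc (f y) <= M.
  move=> Kx; have [r r0 xr] := continuous_normc Kx ltr01.
  exists ([set y | `|x - y| < r], [set M | Normc.normc (f x) + 1 <= M]).
    split => /=; last by apply: nbhs_pinfty_ge; exact: num_real.
    by apply/nbhs_ballP; exists r => //= y; rewrite -ball_normE.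
  move=> [y M] /= [xy xM] Ky; apply: le_trans xM.
  have -> : f y = f x - (f x - f y) by rewrite opprB [RHS]addrC subrK.
  by rewrite (le_trans (normcB _ _))// lerD2l ltW// xr.
move=> /(_ _ cover)[M [_ /(_ (M + 1))]].
by rewrite ltrDl ltr01 => /(_ isT) KM; exists (M + 1) => x Kx; exact: KM.
Qed.

Lemma compact_normc_unif_continuous (e : R) : 0 < e -> exists2 r : R, 0 < r &
  forall x y, K x -> K y -> `|x - y| < r -> Normc.normc (f x - f y) <= e.
Proof.
move=> e0.
have /compact_near_coveringP/(_ _ (0^'+ : set_system R)
  (fun r x => K x -> forall y, K y -> `|x - y| < r -> Normc.normc (f x - f y) <= e)) := cK.
have cover x : K x -> \forall x' \near x & r \near 0^'+,
    K x' -> forall y, K y -> `|x' - y| < r -> Normc.normc (f x' - f y) <= e.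
  move=> Kx; have [r r0 xr] := continuous_normc Kx (divr_gt0 e0 (ltr0n R 2)).
  exists ([set y | `|x - y| < r / 2], [set s | s < r / 2]).
    split => /=; last by apply: nbhs_right_lt; rewrite divr_gt0.
    apply/nbhs_ballP; exists (r / 2) => /=; first by rewrite divr_gt0.
    by move=> y; rewrite -ball_normE.
  move=> [z s] /= [xz sr] Kz y Ky zy.
  have -> : f z - f y = (f x - f y) - (f x - f z) by rewrite opprB [RHS]addrC addrA subrK.
  rewrite (le_trans (normcB _ _))// [e]splitr lerD// ltW// xr//; last lra.
  by rewrite -[x](subrK z) -addrA (le_lt_trans (ler_normD _ _))//; lra.
move=> /(_ _ cover)[r /= r0 Kr].
have r20 : 0 < r / 2 by rewrite divr_gt0.
exists (r / 2) => // x y Kx Ky; apply: (Kr (r / 2)) => //=.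
by rewrite sub0r normrN ger0_norm ?ltW//; lra.
Qed.

End compact_continuity.

(** Correlation is the case of the identity [j], convolution that of the
    opposite. Since [f] is only known on the closure of the sum set, its boundedness
    and uniform continuity come from the compactness of that closure. *)
Lemma translation_kernel_cvg (R : realType) (d : nat) (X Y : set 'rV[R]_d)
    (j : 'rV[R]_d -> 'rV[R]_d) (f : 'rV[R]_d -> R[i]^o) :
  bounded_set X -> open X -> bounded_set Y -> open Y ->
  (forall y, `|j y| = `|y|) -> {morph j : x y / x - y} ->
  {within closure [set x + j y | x in X & y in Y], continuous f} ->
  opnorm_cvg (lebesgue_rV d) (lebesgue_rV d) Y X 0^'+
    (discretization X Y (fun x y : 'rV[R]_d => f (x + j y)))
    (kernel_op (lebesgue_rV d) Y (fun x y : 'rV[R]_d => f (x + j y))).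
Proof.
move=> bX oX bY oY nj jB cf.
set O := [set x + j y | x in X & y in Y] in cf.
have OE x y : X x -> Y y -> closure O (x + j y).
  by move=> Xx Yy; apply: subset_closure; exists x => //; exists y.
have cO : compact (closure O).
  apply: bounded_closed_compact; last exact: closed_closure.
  have [[A A0 XA] [B B0 YB]] := (bounded_set_normP bX, bounded_set_normP bY).
  exists (A + B + 1); split; first exact: num_real.
  move=> M ABM z Oz /=.
  have /Oz[_ [[x Xx [y Yy <-]] zxy]] : nbhs z [set w | `|z - w| < 1].
    by apply/nbhs_ballP; exists 1 => //= w; rewrite -ball_normE.
  rewrite -[z](subrK (x + j y)) (le_trans (ler_normD _ _))//.
  have := ler_normD x (j y); rewrite nj.
  by have := XA x Xx; have := YB y Yy; move: zxy => /=; lra.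
have [M fM] := compact_normc_bounded cO cf.
apply: (@discretization_cvg _ _ X Y _ bX oX bY oY M) => [x y Xx Yy|e e0].
  by apply: fM; exact: OE.
have [r r0 fr] := compact_normc_unif_continuous cO cf e0.
exists (r / 2) => [|x x' y y' Xx Xx' Yy Yy' xx' yy']; first by rewrite divr_gt0.
apply: fr; [exact: OE|exact: OE|].
rewrite opprD addrACA -jB (le_lt_trans (ler_normD _ _))// nj; lra.
Qed.

Theorem theorem6p4 (R : realType) (d : nat) (hd : (1 <= d)%N)
    (Upsilon Xi : set 'rV[R]_d)
    (bUpsilon : bounded_set Upsilon) (oUpsilon : open Upsilon)
    (cUpsilon : connected Upsilon) (wUpsilon : well_behaved_boundary Upsilon)
    (bXi : bounded_set Xi) (oXi : open Xi)
    (cXi : connected Xi) (wXi : well_behaved_boundary Xi) :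
  (forall f : 'rV[R]_d -> R[i]^o,
    {within closure [set x + y | x in Xi & y in Upsilon], continuous f} ->
    opnorm_cvg (lebesgue_rV d) (lebesgue_rV d) Upsilon Xi 0^'+
      (fun l g x => (l ^+ d)%:C%C *
         embedding l Xi (disc_corr_op f l Xi Upsilon
           (adjoint (embedding l Upsilon) g)) x)
      (corr_op f Upsilon)) /\
  (forall f : 'rV[R]_d -> R[i]^o,
    {within closure [set x - y | x in Xi & y in Upsilon], continuous f} ->
    opnorm_cvg (lebesgue_rV d) (lebesgue_rV d) Upsilon Xi 0^'+
      (fun l g x => (l ^+ d)%:C%C *
         embedding l Xi (disc_conv_op f l Xi Upsilon
           (adjoint (embedding l Upsilon) g)) x)
      (conv_op f Upsilon)).
Proof.
split=> f cf.
  apply: (@translation_kernel_cvg _ _ _ _ id) => //.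
apply: (@translation_kernel_cvg _ _ _ _ -%R) => // [y|x y].
  exact: normrN.
exact: opprD.
Qed.
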